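(* Let $k$ be a field and let $\mathcal H$ be a $d$-uniform hypergraph such that the length of the linear strand of $R/I_{\Delta(\mathcal H)}$ is maximal. Then $$\mathrm{depth}_R(R/I_{\Delta(\mathcal H)})=\mathrm{con}(\mathcal H)+d-1 .$$
   Context: A hypergraph $\mathcal H$ consists of a finite vertex set $[n]$ and a finite collection of subsets, called edges; it is $d$-uniform if every edge has cardinality $d$. All hypergraphs are simple (every edge has at least two vertices, so $d\ge 2$, and no edge contains another). The clique complex is $\Delta(\mathcal H)=\{F\subseteq[n]: \text{every } d\text{-subset of }F\text{ is an edge of }\mathcal H\}$. For a simplicial complex $\Delta$ and $V\subseteq[n]$, $\Delta_V=\{F\in\Delta: F\subseteq V\}$. The connectivity over $k$ of $\mathcal H$ is $\mathrm{con}(\mathcal H)=\min\{|V| : V\subseteq[n],\ \dim_k\tilde H_{d-2}(\Delta(\mathcal H)_{[n]\setminus V};k)\neq0\}$, where $\tilde H$ denotes reduced simplicial homology. $R=k[x_1,\dots,x_n]$, $I_\Delta$ is the Stanley–Reisner ideal, and $\beta_{i,j}(M)=\dim_k\mathrm{Tor}_i^R(M,k)_j$. The linear strand of $R/I_{\Delta(\mathcal H)}$ is the part of the minimal graded free resolution in (homological, internal) degrees $(i,i+d-1)$; its length is maximal if $\max\{i : \beta_{i,i+d-1}(R/I_{\Delta(\mathcal H)})\neq0\}=\mathrm{pd}_R(R/I_{\Delta(\mathcal H)})$, i.e. $\beta_{p,p+d-1}(R/I_{\Delta(\mathcal H)})\ne0$ for $p=\mathrm{pd}_R(R/I_{\Delta(\mathcal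 H)})$ the projective dimension. *)

(* Defs.v *)
From HB Require Import structures.
From mathcomp Require Import all_boot all_order all_algebra.
From mathcomp Require Import boolp.
From mathcomp Require Import mpoly.

Set Implicit Arguments.
Unset Strict Implicit.
Unset Printing Implicit Defensive.

Import GRing.Theory.
Local Open Scope ring_scope.
Local Open Scope quotient_scope.

(* dim (ker dout / im din) for C --din--> A --dout--> B with din *m dout = 0;
   matrices act on row vectors, on the right. *)
Definition homology_dim (k : fieldType) (a b c : nat)
    (din : 'M[k]_(c, a)) (dout : 'M[k]_(a, b)) : nat :=
  (\rank (kermx dout) - \rank din)%N.

Section Combinatorics.
Variable n : nat.
Implicit Types (H Delta : {set {set 'I_n}}) (V : {set 'I_n}).

Definition simple_hypergraph H : Prop :=
  (forall E, E \in H -> (1 < #|E|)%N) /\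
  (forall E E', E \in H -> E' \in H -> E \subset E' -> E = E').

Definition uniform (d : nat) H : Prop := forall E, E \in H -> #|E| = d.

Definition clique_complex (d : nat) H : {set {set 'I_n}} :=
  [set F : {set 'I_n} | [forall E : {set 'I_n}, (E \subset F) && (#|E| == d) ==> (E \in H)]].

Definition induced Delta V : {set {set 'I_n}} := [set F in Delta | F \subset V].

(* Faces with m elements, i.e. of dimension m - 1 (m = 0: the empty face). *)
Definition faces Delta (m : nat) : {set {set 'I_n}} :=
  [set F in Delta | #|F| == m].

(* The boundary C_q -> C_(q-1) of the augmented oriented chain complex: the
   row of F = {v_0 < ... < v_q} is sum_i (-1)^i (F :\ v_i). *)
Definition boundary (k : fieldType) Delta (q : nat) :
    'M[k]_(#|faces Delta q.+1|, #|faces Delta q|) :=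
  \matrix_(i, j)
    let F : {set 'I_n} := enum_val i in let G : {set 'I_n} := enum_val j in
    \sum_(v in F | G == F :\ v) (-1) ^+ #|[set u in F | (u < v)%N]|.

Definition reduced_homology_dim (k : fieldType) Delta (q : nat) : nat :=
  homology_dim (boundary k Delta q.+1) (boundary k Delta q).

(* The value n.+1, larger than every #|V|, stands for the minimum of the empty
   set. *)
Definition con (k : fieldType) (d : nat) H : nat :=
  \big[minn/n.+1]_(V : {set 'I_n} |
      reduced_homology_dim k (induced (clique_complex d H) (~: V)) (d - 2) != 0%N)
    #|V|.

End Combinatorics.

Section ProjectiveDimension.
Variable R : comNzRingType.

Definition projective (P : lmodType R) : Prop :=
  forall (M N : lmodType R) (g : {linear M -> N}) (f : {linear P -> N}),
    (forall y, exists x, g x = y) ->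
  exists h : {linear P -> M}, forall x, g (h x) = f x.

Definition projective_resolution_of_length (M : lmodType R) (p : nat) : Prop :=
  exists (P : nat -> lmodType R) (d : forall i, {linear P i.+1 -> P i})
         (e : {linear P 0%N -> M}),
  [/\ forall i, projective (P i),
      forall y, exists x, e x = y,
      forall x, e x = 0 <-> exists y, d 0%N y = x,
      forall i x, d i x = 0 <-> exists y, d i.+1 y = x
    & forall i, (p < i)%N -> forall x : P i, x = 0].

Definition is_projdim (M : lmodType R) (p : nat) : Prop :=
  projective_resolution_of_length M p /\
  forall q, projective_resolution_of_length M q -> (p <= q)%N.

End ProjectiveDimension.

Section Depth.
Variables (R : comNzRingType) (M : lmodType R).

(* x belongs to (s_0, ..., s_(r-1)) M *)
Definition in_seqM (s : seq R) (x : M) : Prop :=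
  exists y : 'I_(size s) -> M, x = \sum_(j < size s) s`_j *: y j.

Definition regular_sequence (s : seq R) : Prop :=
  (forall i, (i < size s)%N -> forall x : M,
     in_seqM (take i s) (s`_i *: x) -> in_seqM (take i s) x) /\
  (exists x : M, ~ in_seqM s x).

Definition is_depth (m : R -> Prop) (r : nat) : Prop :=
  (exists s : seq R,
     [/\ size s = r, forall f, f \in s -> m f & regular_sequence s]) /\
  (forall s : seq R,
     (forall f, f \in s -> m f) -> regular_sequence s -> (size s <= r)%N).

End Depth.

Section Betti.
Variables (k : fieldType) (n : nat).
Local Notation R := {mpoly k[n]}.

(* The ideal (x_1, ..., x_n): zero constant term. *)
Definition irrelevant_ideal (f : R) : Prop := f@_0%MM = 0.

(* grM j is the degree j part of M, which is graded in nonnegative degrees.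
   F_i = \bigoplus_(s < gf_rank i) R(- gf_shift s), an element being the row
   vector of its coordinates; gf_diff i : F_(i+1) -> F_i. *)
Record graded_free_resolution (M : lmodType R) (grM : nat -> M -> Prop) := {
  gf_rank : nat -> nat;
  gf_shift : forall i, 'I_(gf_rank i) -> nat;
  gf_diff : forall i, 'M[R]_(gf_rank i.+1, gf_rank i);
  gf_aug : 'I_(gf_rank 0) -> M;
  gf_diff_homog : forall i s t, gf_diff i s t != 0 ->
    exists2 e, gf_diff i s t \is e.-homog & gf_shift s = (gf_shift t + e)%N;
  gf_aug_homog : forall s, grM (gf_shift s) (gf_aug s);
  gf_aug_surj : forall x : M, exists v : 'rV[R]_(gf_rank 0),
    x = \sum_s v 0 s *: gf_aug s;
  gf_exact0 : forall v : 'rV[R]_(gf_rank 0),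
    \sum_s v 0 s *: gf_aug s = 0 <-> exists w, w *m gf_diff 0 = v;
  gf_exact : forall i (v : 'rV[R]_(gf_rank i.+1)),
    v *m gf_diff i = 0 <-> exists w, w *m gf_diff i.+1 = v
}.

Section Tor.
Variables (M : lmodType R) (grM : nat -> M -> Prop).
Variable F : graded_free_resolution grM.

(* (F_i (x) k)_j has for basis the generators of F_i of degree j, because
   k = R/(x_1, ..., x_n) is concentrated in degree 0. *)
Definition gens (i j : nat) : {set 'I_(gf_rank F i)} :=
  [set s | gf_shift s == j].

(* The degree j part of gf_diff i (x) k. *)
Definition tor_diff (i j : nat) : 'M[k]_(#|gens i.+1 j|, #|gens i j|) :=
  \matrix_(a, b) (gf_diff F i (enum_val a) (enum_val b))@_0%MM.

(* dim_k H_i(F (x) k)_j = dim_k Tor_i(M, k)_j *)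
Definition tor_dim (i j : nat) : nat :=
  match i with
  | 0 => homology_dim (tor_diff 0 j) (0 : 'M_(_, 0))
  | i'.+1 => homology_dim (tor_diff i'.+1 j) (tor_diff i' j)
  end.

End Tor.

(* tor_dim F i j does not depend on the resolution F. *)
Definition is_betti (M : lmodType R) (grM : nat -> M -> Prop) (i j b : nat) :
    Prop :=
  exists F : graded_free_resolution grM, tor_dim F i j = b.

(* The linear strand of M, in degrees (i, i + d - 1), has length pd M. *)
Definition maximal_linear_strand (M : lmodType R) (grM : nat -> M -> Prop)
    (d : nat) : Prop :=
  exists p b, [/\ is_projdim M p, is_betti grM p (p + d - 1) b & b <> 0%N].

End Betti.

Section StanleyReisner.
Variables (k : fieldType) (n : nat) (Delta : {set {set 'I_n}}).
Local Notation R := {mpoly k[n]}.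

Definition SR_ideal : {pred R} := fun f =>
  `[< exists c : {set 'I_n} -> R,
        f = \sum_(N : {set 'I_n} | N \notin Delta) c N * \prod_(i in N) 'X_i >].

Fact SR_ideal_zmod_closed : zmod_closed SR_ideal.
Proof.
split=> [|f g /asboolP[c ->] /asboolP[c' ->]]; apply/asboolP.
  by exists (fun=> 0); rewrite big1 // => N _; rewrite mul0r.
exists (fun N => c N - c' N); rewrite -sumrB.
by apply: eq_bigr => N _; rewrite mulrBl.
Qed.

HB.instance Definition _ :=
  GRing.isZmodClosed.Build R SR_ideal SR_ideal_zmod_closed.

Fact SR_idealMl (a f : R) : f \in SR_ideal -> a * f \in SR_ideal.
Proof.
move=> /asboolP[c ->]; apply/asboolP; exists (fun N => a * c N).
by rewrite mulr_sumr; apply: eq_bigr => N _; rewrite mulrA.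
Qed.

(* R / I_Delta *)
Definition SR_quot : Type := {ideal_quot SR_ideal}.
HB.instance Definition _ := GRing.Zmodule.on SR_quot.

Definition SR_pi (f : R) : SR_quot := \pi_({ideal_quot SR_ideal}) f.

Definition SR_scale (a : R) (x : SR_quot) : SR_quot :=
  SR_pi (a * repr (x : {ideal_quot SR_ideal})).

Fact SR_scale_pi (a f : R) : SR_scale a (SR_pi f) = SR_pi (a * f).
Proof.
apply/eqP; rewrite /SR_scale /SR_pi -Quotient.idealrBE -mulrBr SR_idealMl //.
by rewrite Quotient.idealrBE reprK.
Qed.

Fact SR_piP (x : SR_quot) : exists f, x = SR_pi f.
Proof. by exists (repr (x : {ideal_quot SR_ideal})); rewrite /SR_pi reprK. Qed.

Fact SR_piD (f g : R) : SR_pi (f + g) = SR_pi f + SR_pi g.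
Proof. exact: (raddfD \pi_({ideal_quot SR_ideal})). Qed.

Fact SR_scaleA a b x : SR_scale a (SR_scale b x) = SR_scale (a * b) x.
Proof. by have [f ->] := SR_piP x; rewrite !SR_scale_pi mulrA. Qed.

Fact SR_scale1 : left_id 1 SR_scale.
Proof. by move=> x; have [f ->] := SR_piP x; rewrite SR_scale_pi mul1r. Qed.

Fact SR_scaleDr : right_distributive SR_scale +%R.
Proof.
move=> a x y; have [f ->] := SR_piP x; have [g ->] := SR_piP y.
by rewrite -SR_piD !SR_scale_pi mulrDr SR_piD.
Qed.

Fact SR_scaleDl x : {morph SR_scale^~ x : a b / a + b}.
Proof.
by move=> a b; have [f ->] := SR_piP x; rewrite !SR_scale_pi mulrDl SR_piD.
Qed.

HB.instance Definition _ := GRing.Zmodule_isLmodule.Build R SR_quot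
  SR_scaleA SR_scale1 SR_scaleDr SR_scaleDl.

Definition SR_graded (j : nat) (x : SR_quot) : Prop :=
  exists2 f : R, f \is j.-homog & x = SR_pi f.

End StanleyReisner.

(* Main.v *)
(* The depth of [R / I_Delta] and the numbers [con] and [pd] are compared through
   the Koszul homology [H_i] of [R / I_Delta] with respect to the variables.

   - A projective resolution of length [p] gives [H_i = 0] for [i > p], and a
     nonzero [beta_(p, p + d - 1)] gives a nonzero class of [H_p] in internal
     degree [p + d - 1] (dimension shifting along the resolution).
   - Splitting [H_p] into its multigraded parts (Hochster's formula) turns this
     class into a set [W] of [p + d - 1] vertices with nonzero reduced homology
     in degree [d - 2], and any such set [W'] into a nonzero [H_i] with
     [i = #|W'| - d + 1], so that [i <= p]; hence [con = n - (p + d - 1)].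
   - A regular sequence of length [r] kills [H_i] for [i > n - r], so depth is at
     most [n - p].  Conversely, if [H_i = 0] for [i > n - r], the elementary
     symmetric polynomials [e_1, ..., e_r] form a regular sequence: this avoids
     prime avoidance and works over finite fields.  It is proved by induction on
     [r], through the submodule spanned by the monomials whose support is a face
     with at least [r] elements.  That submodule is filtered by copies of
     polynomial rings in at least [r] variables, and the quotient is the face
     ring of a skeleton. *)

Require Import Defs.
From HB Require Import structures.
From mathcomp Require Import all_boot all_order all_algebra.
From mathcomp Require Import boolp.
From mathcomp Require Import finmap monalg mpoly.
From mathcomp Require Import ring zify.

Set Implicit Arguments.
Unset Strict Implicit.
Unset Printing Implicit Defensive.

Import GRing.Theory.
Local Open Scope ring_scope.

(** * Submodules *)

Section Submodules.
Variables (R : comNzRingType) (L : lmodType R).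
Implicit Types (A B C : L -> Prop) (u v : L) (a : R).

(** Submodules are predicates on one ambient module, so that a subquotient is just a pair [A], [B],
    read as [A / (A :&: B)], and no quotient module has to be built. *)
Definition is_submod B : Prop :=
  B 0 /\ forall a u v, B u -> B v -> B (a *: u + v).

Definition full_submod : L -> Prop := fun=> True.
Definition null_submod : L -> Prop := fun u => u = 0.

Definition add_scaled B a A : L -> Prop :=
  fun u => exists b v, [/\ B b, A v & u = b + a *: v].

Lemma submod0 B : is_submod B -> B 0. Proof. by case. Qed.

Lemma submodD B u v : is_submod B -> B u -> B v -> B (u + v).
Proof. by move=> [_ h] Bu Bv; rewrite -[u]scale1r; apply: h. Qed.

Lemma submodZ B a u : is_submod B -> B u -> B (a *: u).
Proof. by move=> [h0 h] Bu; rewrite -[a *: u]addr0; apply: h. Qed.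

Lemma submodN B u : is_submod B -> B u -> B (- u).
Proof. by move=> sB Bu; rewrite -scaleN1r; apply: submodZ. Qed.

Lemma submodB B u v : is_submod B -> B u -> B v -> B (u - v).
Proof. by move=> sB Bu Bv; apply: submodD => //; apply: submodN. Qed.

Lemma submod_addr B u v : is_submod B -> B v -> B (u + v) -> B u.
Proof. by move=> sB Bv Buv; rewrite -[u](addrK v); apply: submodB. Qed.

Lemma submod_sum B (I : finType) (P : pred I) (F : I -> L) :
  is_submod B -> (forall i, P i -> B (F i)) -> B (\sum_(i | P i) F i).
Proof.
move=> sB BF; apply: (big_ind B) => //; first exact: submod0.
by move=> u v; apply: submodD.
Qed.

Lemma full_submodP : is_submod full_submod. Proof. by []. Qed.

Lemma null_submodP : is_submod null_submod.
Proof. by split=> // a u v -> ->; rewrite scaler0 addr0. Qed.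

Lemma add_scaledP B a A :
  is_submod B -> is_submod A -> is_submod (add_scaled B a A).
Proof.
move=> sB sA; split=> [|c u v [b [w [Bb Aw ->]]] [b' [w' [Bb' Aw' ->]]]].
  by exists 0, 0; split; [exact: submod0 | exact: submod0 | rewrite scaler0 addr0].
exists (c *: b + b'), (c *: w + w'); split; [exact: (proj2 sB)| exact: (proj2 sA) |].
by rewrite !scalerDr !scalerA addrACA [a * c]mulrC.
Qed.

Lemma add_scaledl B a A u : is_submod A -> B u -> add_scaled B a A u.
Proof.
by move=> sA Bu; exists u, 0; split=> //; [exact: submod0 | rewrite scaler0 addr0].
Qed.

Lemma add_scaledr B a A u : is_submod B -> A u -> add_scaled B a A (a *: u).
Proof. by move=> sB Au; exists 0, u; split=> //; [exact: submod0 | rewrite add0r]. Qed.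

End Submodules.

Arguments full_submod {R L}.
Arguments null_submod {R L}.

(** * Koszul homology of subquotients *)

Section Koszul.
Variables (R : comNzRingType) (n : nat) (x : 'I_n -> R).

(** The sign used in [boundary], here also for [v] outside [S]; this prepares the comparison with
    simplicial cochains. *)
Definition ksign (v : 'I_n) (S : {set 'I_n}) : R :=
  (-1) ^+ #|[set u in S | (u < v)%N]|.

Lemma ksignM v S : ksign v S * ksign v S = 1.
Proof. by rewrite /ksign -expr2 sqrr_sign. Qed.

Lemma ksign0 v : ksign v set0 = 1.
Proof.
rewrite /ksign [X in #|pred_of_set X|](_ : _ = set0) ?cards0 //.
by apply/setP=> u; rewrite !inE.
Qed.

Lemma ksignU u v (S : {set 'I_n}) : v \notin S ->
  ksign u (v |: S) = (-1) ^+ (v < u)%N * ksign u S.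
Proof.
move=> vS; rewrite /ksign -exprD; congr (_ ^+ _); case: ltnP => vu.
  rewrite [in LHS](_ : [set _ in _ | _] = v |: [set w in S | (w < u)%N]).
    by rewrite cardsU1 inE (negbTE vS) add1n.
  by apply/setP=> w; rewrite !inE; case: eqP => //= ->; rewrite vu.
rewrite add0n; congr #|pred_of_set _|; apply/setP=> w; rewrite !inE.
by case: eqP => //= ->; rewrite ltnNge vu andbF.
Qed.

(** Exactly one of [u] and [v] is the smaller one, so exactly one of the two insertions changes a
    sign. *)
Lemma ksign_anticomm u v (S : {set 'I_n}) :
  u \notin S -> v \notin S -> u != v ->
  ksign v S * ksign u (v |: S) = - (ksign u S * ksign v (u |: S)).
Proof.
move=> uS vS uv; rewrite !ksignU // mulrCA [in RHS]mulrCA [ksign u S * _]mulrC.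
have -> : (u < v)%N = ~~ (v < u)%N by rewrite -leqNgt ltn_neqAle val_eqE uv.
by case: (v < u)%N; rewrite ?expr0 ?expr1 !mulN1r !mul1r ?opprK.
Qed.

Variable L : lmodType R.
Implicit Types (A B C : L -> Prop) (c b : {set 'I_n} -> L) (S T : {set 'I_n}).

(* The Koszul complex of [L]: a chain is a family of coefficients [c S] of the
   exterior monomials [e_S]. *)
Definition kdiff c S : L :=
  \sum_(v | v \notin S) (ksign v S * x v) *: c (v |: S).

(** Exterior multiplication by [e_v], a homotopy between multiplication by [x v] and zero. *)
Definition khomot v c S : L :=
  if v \in S then ksign v (S :\ v) *: c (S :\ v) else 0.

Lemma eq_kdiff c c' S :
  (forall T, #|T| = #|S|.+1 -> c T = c' T) -> kdiff c S = kdiff c' S.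
Proof.
by move=> h; apply: eq_bigr => v vS; rewrite h // cardsU1 vS.
Qed.

Lemma kdiffB c c' S : kdiff (fun T => c T - c' T) S = kdiff c S - kdiff c' S.
Proof. by rewrite -sumrB /=; apply: eq_bigr => v _; rewrite scalerBr. Qed.

Lemma kdiffZ a c S : kdiff (fun T => a *: c T) S = a *: kdiff c S.
Proof.
by rewrite scaler_sumr; apply: eq_bigr => v _; rewrite !scalerA [a * _]mulrC.
Qed.

Lemma kdiff_sum (I : finType) (c : I -> {set 'I_n} -> L) S :
  kdiff (fun T => \sum_i c i T) S = \sum_i kdiff (c i) S.
Proof.
by rewrite exchange_big; apply: eq_bigr => v _; rewrite scaler_sumr.
Qed.

Lemma submod_kdiff B c S : is_submod B ->
  (forall T, #|T| = #|S|.+1 -> B (c T)) -> B (kdiff c S).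
Proof.
move=> sB h; apply: submod_sum => // v vS; apply: submodZ => //.
by apply: h; rewrite cardsU1 vS.
Qed.

(** The double sum runs over ordered pairs of distinct elements outside [S]; swapping a pair changes
    the sign of its term. *)
Lemma kdiff_kdiff c S : kdiff (kdiff c) S = 0.
Proof.
pose f v u := (ksign v S * x v * (ksign u (v |: S) * x u)) *: c (u |: (v |: S)).
have fC u v : u \notin S -> v \notin S -> u != v -> f v u = - f u v.
  move=> uS vS uv; rewrite /f setUCA -scaleNr; congr (_ *: _).
  by rewrite mulrACA ksign_anticomm // mulNr [in RHS]mulrACA [x v * x u]mulrC.
have -> : kdiff (kdiff c) S =
    \sum_(p | [&& p.1 \notin S, p.2 \notin S & p.1 != p.2]) f p.1 p.2.
  rewrite [LHS](eq_bigr (fun v => \sum_(u | (u \notin S) && (v != u)) f v u)).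
    rewrite pair_big_dep /=; apply: eq_bigl => p.
    by rewrite /=; case: (_ \notin S).
  move=> v vS; rewrite scaler_sumr; apply: eq_big => [u|u _].
    by rewrite !inE negb_or andbC eq_sym.
  by rewrite scalerA.
rewrite (bigID (fun p : 'I_n * 'I_n => (p.1 < p.2)%N)) /=.
rewrite [X in _ + X](reindex_inj (h := fun p => (p.2, p.1))) /=; last first.
  by move=> [a b] [a' b'] [-> ->].
rewrite -[RHS](addrN (\sum_(p | [&& p.1 \notin S, p.2 \notin S & p.1 != p.2]
  && (p.1 < p.2)%N) f p.1 p.2)); congr (_ + _); rewrite -sumrN.
apply: eq_big => [[u v]|[u v] /=].
  rewrite /= -leqNgt [(u <= v)%N]leq_eqVlt val_eqE eq_sym.
  by case: (u \notin S); case: (v \notin S); case: (u == v).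
by case/andP=> /and3P[vS uS uv] _; rewrite fC // eq_sym.
Qed.

(** If [v] is in [S], the second summand contributes [x v *: c S] and its other terms cancel the
    first summand. Otherwise only the index [v] of the first summand survives. *)
Lemma khomotK v c S : kdiff (khomot v c) S + khomot v (kdiff c) S = x v *: c S.
Proof.
rewrite /khomot; case: ifPn => vS.
  have vT : v \notin S :\ v by rewrite !inE eqxx.
  have SE : v |: (S :\ v) = S by rewrite setD1K.
  rewrite {1}/kdiff [X in _ + _ *: X]/kdiff (bigD1 v vT) /= SE scalerDr scalerA.
  rewrite mulrA ksignM mul1r addrCA -[RHS]addr0; congr (_ + _).
  rewrite scaler_sumr -[RHS](subrr (\sum_(i | (i \notin S :\ v) && (i != v))
     ksign v (S :\ v) *: ((ksign i (S :\ v) * x i) *: c (i |: S :\ v)))) addrC.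
  congr (_ + _); rewrite -sumrN; apply: eq_big => [u|u uS].
    by rewrite !inE; case: eqP => [->|]; rewrite ?vS ?andbT.
  have uv : u != v by apply: contraNneq uS => ->.
  have -> : (u |: S) :\ v = u |: S :\ v.
    apply/setP=> w; rewrite !inE; case: (eqVneq w u) => [->|]; rewrite ?uv //=.
  rewrite inE vS orbT !scalerA -scaleNr; congr (_ *: _).
  rewrite -{1}SE mulrAC mulrA -mulNr; congr (_ * _).
  have uT : u \notin S :\ v by rewrite !inE (negbTE uS) andbF.
  have [uv'|vu'|/val_inj uv'] := ltngtP u v; last by rewrite uv' eqxx in uv.
    by rewrite !ksignU // uv' ltnNge (ltnW uv') expr0 expr1; ring.
  by rewrite !ksignU // vu' ltnNge (ltnW vu') expr0 expr1; ring.
rewrite addr0 /kdiff (bigD1 v vS) /= big1 => [|u /andP[uS uv]].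
  by rewrite setU11 setU1K // scalerA mulrAC ksignM mul1r addr0.
by rewrite !inE eq_sym (negbTE uv) (negbTE vS) scaler0.
Qed.

Lemma submod_khomot B v c S : is_submod B ->
  (forall T, #|T|.+1 = #|S| -> B (c T)) -> B (khomot v c S).
Proof.
move=> sB h; rewrite /khomot; case: ifP => vS; last exact: submod0.
by apply: submodZ => //; apply: h; rewrite (cardsD1 v S) vS.
Qed.

(* The Koszul homology of [A / (A :&: B)] vanishes in degree [i]. *)
Definition kvanish A B (i : nat) : Prop :=
  forall c, (forall S, A (c S)) -> (forall T, #|T|.+1 = i -> B (kdiff c T)) ->
  exists2 b, forall S, A (b S) & forall S, #|S| = i -> B (c S - kdiff b S).

Lemma kvanish_big A B i : is_submod A -> (n < i)%N -> kvanish A B i.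
Proof.
move=> sA ni c _ _; exists (fun=> 0) => [S|S Si]; first exact: submod0.
by have := max_card (mem S); rewrite card_ord Si leqNgt ni.
Qed.

Definition in_span (s : R) : Prop := exists a : 'I_n -> R, s = \sum_v a v * x v.

(* Multiplication by [s] is null-homotopic, so the connecting map
   [H_(i+1) (A / (B + s A)) -> H_i (A / B)] is onto. *)
Lemma kvanish_of_quotient A B s i : is_submod A -> is_submod B -> in_span s ->
  (forall a, A a -> B (s *: a) -> B a) ->
  kvanish A (add_scaled B s A) i.+1 -> kvanish A B i.
Proof.
move=> sA sB [r rE] sreg hv c cA cB.
(* Since [s] is the sum of the [r v * x v], exterior multiplication by the sum of the [r v *: e_v]
   is a homotopy for [s]. *)
pose h b S := \sum_v r v *: khomot v b S.
have hE S : kdiff (h c) S + h (kdiff c) S = s *: c S.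
  rewrite /h kdiff_sum -big_split /= rE scaler_suml; apply: eq_bigr => v _.
  by rewrite kdiffZ -scalerDr khomotK scalerA.
have hB S : #|S| = i -> B (h (kdiff c) S).
  move=> Si; apply: submod_sum => // v _; apply: submodZ => //.
  by apply: submod_khomot => // T; rewrite Si; apply: cB.
(* By [hE] and [hB], the chain [h c] is a cycle modulo [B + s A] in degree [i.+1]. *)
have [||b' b'A b'E] := hv (h c).
- move=> S; apply: submod_sum => // v _; apply: submodZ => //.
  exact: submod_khomot.
- move=> S [Si]; rewrite -[kdiff _ S](addrK (h (kdiff c) S)) hE addrC.
  exists (- h (kdiff c) S), (c S); split=> //; apply: submodN => //; exact: hB.
have /choice[a aP] S : exists a, A a /\
    (#|S| = i.+1 -> B (h c S - kdiff b' S - s *: a)).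
  have [Si|Si] := eqVneq #|S| i.+1; last first.
    by exists 0; split=> [|/eqP]; [exact: submod0 | rewrite (negbTE Si)].
  have [b [a [Bb Aa E]]] := b'E S Si.
  by exists a; split=> // _; rewrite E addrK.
exists a => [S|S Si]; first by case: (aP S).
(* Applying [kdiff] to [h c - kdiff b' - s *: a] leaves [s *: (c - kdiff a)] modulo [B], and [s] can
   be cancelled. *)
apply: sreg; first by apply: submodB => //; apply: submod_kdiff => // T _; case: (aP T).
have: B (kdiff (fun T => h c T - kdiff b' T - s *: a T) S).
  by apply: submod_kdiff => // T; rewrite Si => /(proj2 (aP T)).
rewrite !kdiffB kdiff_kdiff subr0 kdiffZ scalerBr -hE addrAC => hB'.
by apply: submodD => //; apply: hB.
Qed.

(** The long exact sequence of [0 -> A/B -> A/B -> A/(B + s A) -> 0] places the group between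
    [H_(i+1)] and [H_i] of [A/B]. *)
Lemma kvanish_quotient A B s i : is_submod A -> is_submod B ->
  (forall a, A a -> B (s *: a) -> B a) ->
  kvanish A B i -> kvanish A B i.+1 -> kvanish A (add_scaled B s A) i.+1.
Proof.
move=> sA sB sreg hv hv' c cA cB.
(* The family [a] represents the image of the class of [c] under the connecting map. *)
have /choice[a aP] S : exists a, A a /\ (#|S| = i -> B (kdiff c S - s *: a)).
  have [Si|Si] := eqVneq #|S| i; last first.
    by exists 0; split=> [|/eqP]; [exact: submod0 | rewrite (negbTE Si)].
  have [b [a [Bb Aa E]]] := cB S (congr1 succn Si).
  by exists a; split=> // _; rewrite E addrK.
have aA S : A (a S) by case: (aP S).
have [|a' a'A a'E] := hv a aA.
  move=> T Ti; apply: sreg; first exact: submod_kdiff.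
  have: B (kdiff (fun S => kdiff c S - s *: a S) T).
    by apply: submod_kdiff => // S; rewrite Ti => /(proj2 (aP S)).
  by rewrite kdiffB kdiff_kdiff sub0r kdiffZ -scalerN => /(submodN sB);
    rewrite scalerN opprK.
have [||c' c'A c'E] := hv' (fun S => c S - s *: a' S).
- by move=> S; apply: submodB => //; apply: submodZ.
- move=> T [Ti]; rewrite kdiffB kdiffZ.
  have -> : kdiff c T - s *: kdiff a' T =
     (kdiff c T - s *: a T) + s *: (a T - kdiff a' T).
    by rewrite scalerBr addrA subrK.
  by apply: submodD => //; [case: (aP T) => _; apply | apply: submodZ => //; apply: a'E].
exists c' => // S Si; exists (c S - s *: a' S - kdiff c' S), (a' S).
by split=> //; [exact: c'E | rewrite addrAC subrK].
Qed.

(** The long exact sequence of [0 -> C/B -> A/B -> A/C -> 0] places the group between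
    [H_(i+1) (A/B)] and [H_i (C/B)]. *)
Lemma kvanish_ses A B C i : is_submod A -> is_submod B -> is_submod C ->
  (forall u, B u -> C u) -> (forall u, C u -> A u) ->
  kvanish A B i.+1 -> kvanish C B i -> kvanish A C i.+1.
Proof.
move=> sA sB sC BC CA hv hv' c cA cC.
(* [kvanish] asks for every coefficient to lie in [C], which is known for [kdiff c] only in degree
   [i]; the others are set to [0]. *)
pose c0 S := if #|S| == i then kdiff c S else 0.
have c0E S : #|S| = i -> c0 S = kdiff c S by rewrite /c0 => ->; rewrite eqxx.
have [||c' c'C c'E] := hv' c0.
- by move=> S; rewrite /c0; case: eqP => Si; [apply: cC; rewrite Si | exact: submod0].
- move=> T Ti; rewrite (@eq_kdiff _ (kdiff c)) ?kdiff_kdiff; first exact: submod0.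
  by move=> S ST; apply: c0E; rewrite ST.
have [||b bA bE] := hv (fun S => c S - c' S).
- by move=> S; apply: submodB => //; apply: CA.
- by move=> T [Ti]; rewrite kdiffB -c0E //; apply: c'E.
exists b => // S Si; have /BC := bE S Si.
rewrite addrAC => h; rewrite -[X in C X](subrK (c' S)).
exact: submodD.
Qed.

End Koszul.

(** * Koszul homology under an isomorphism of subquotients *)

Section KoszulTransport.
Variables (R : comNzRingType) (n : nat) (x : 'I_n -> R) (L L' : lmodType R).
Variable phi : {linear L -> L'}.

Lemma kdiff_linear c S : kdiff x (fun T => phi (c T)) S = phi (kdiff x c S).
Proof. by rewrite linear_sum; apply: eq_bigr => v _; rewrite linearZ. Qed.

Variables (A B : L -> Prop) (A' B' : L' -> Prop).
Hypotheses (sA : is_submod A) (sB' : is_submod B').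
Hypothesis phiA : forall a, A a -> A' (phi a).
Hypothesis phi_onto : forall a', A' a' -> exists2 a, A a & B' (a' - phi a).
Hypothesis phiB : forall a, A a -> B' (phi a) <-> B a.

(** The hypotheses on [phi] say that it induces an isomorphism from [A/B] to [A'/B']. Cycles are
    lifted along it coefficient by coefficient and the bounding chain is pushed forward. *)
Lemma kvanish_transport i : kvanish x A B i -> kvanish x A' B' i.
Proof.
move=> hv c cA cB.
have /choice[f fP] S : exists a, A a /\ B' (c S - phi a).
  by have [a Aa Ba] := phi_onto (cA S); exists a.
have fA S : A (f S) by case: (fP S).
have [|b bA bE] := hv f fA.
  move=> T Ti; apply/phiB; first exact: submod_kdiff.
  rewrite -kdiff_linear -[X in B' X](subKr (kdiff x c T)); apply: submodB => //.
    exact: cB.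
  by rewrite -kdiffB; apply: submod_kdiff => // S _; case: (fP S).
exists (fun S => phi (b S)) => [S|S Si]; first exact: phiA.
have -> : c S - kdiff x (fun S => phi (b S)) S =
    (c S - phi (f S)) + phi (f S - kdiff x b S).
  by rewrite kdiff_linear linearB addrA subrK.
apply: submodD => //; first by case: (fP S).
by apply/phiB; [apply: submodB => //; apply: submod_kdiff | apply: bE].
Qed.

Lemma kvanish_reflect i : is_submod B -> is_submod A' ->
  kvanish x A' B' i -> kvanish x A B i.
Proof.
move=> sB sA' hv c cA cB.
have [||b bA bE] := hv (fun S => phi (c S)).
- by move=> S; apply: phiA.
- move=> T Ti; rewrite kdiff_linear; apply/phiB; first exact: submod_kdiff.
  exact: cB.
have /choice[f fP] S : exists a, A a /\ B' (b S - phi a).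
  by have [a Aa Ba] := phi_onto (bA S); exists a.
have fA S : A (f S) by case: (fP S).
exists f => // S Si; apply/phiB.
  by apply: submodB => //; apply: submod_kdiff.
rewrite linearB -kdiff_linear.
have -> : phi (c S) - kdiff x (fun S => phi (f S)) S =
   (phi (c S) - kdiff x b S) + kdiff x (fun S => b S - phi (f S)) S.
  by rewrite kdiffB addrA subrK.
apply: submodD => //; first exact: bE.
by apply: submod_kdiff => // T _; case: (fP T).
Qed.

End KoszulTransport.

(** * Weakly regular sequences *)

Section RegularSequences.
Variables (R : comNzRingType) (L : lmodType R).
Implicit Types (A B C : L -> Prop) (s t : seq R).

(** This is [B + (s) A], built by the recursion of [wreg] so that both unfold together. *)
Fixpoint quot_by B A s : L -> Prop :=
  if s is x :: s' then quot_by (add_scaled B x A) A s' else B.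

(* [s] is weakly regular on [A / (A :&: B)]. *)
Fixpoint wreg A B s : Prop :=
  if s is x :: s' then
    (forall a, A a -> B (x *: a) -> B a) /\ wreg A (add_scaled B x A) s'
  else True.

Lemma quot_by_submod B A s :
  is_submod B -> is_submod A -> is_submod (quot_by B A s).
Proof.
by move=> + sA; elim: s B => //= y s IH B sB; apply/IH/add_scaledP.
Qed.

Lemma quot_by_incl B A s u : is_submod A -> B u -> quot_by B A s u.
Proof.
by move=> sA; elim: s B => //= y s IH B Bu; apply/IH/add_scaledl.
Qed.

Lemma quot_by_mem B A s y u : is_submod B -> is_submod A ->
  y \in s -> A u -> quot_by B A s (y *: u).
Proof.
move=> + sA + Au; elim: s B => //= z s IH B sB; rewrite inE => /orP[/eqP->|ys].
  by apply: quot_by_incl => //; apply: add_scaledr.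
by apply: IH => //; apply: add_scaledP.
Qed.

Lemma quot_by_min B A D s u : is_submod D ->
  (forall v, B v -> D v) -> (forall y v, y \in s -> A v -> D (y *: v)) ->
  quot_by B A s u -> D u.
Proof.
move=> sD; elim: s B => [|y s IH] B BD AD /=; first exact: BD.
apply: IH => [v [b [w [Bb Aw ->]]]|z v zs]; last by apply: AD; rewrite inE zs orbT.
by apply: submodD => //; [exact: BD | apply: AD => //; rewrite inE eqxx].
Qed.

Lemma wreg_cat A B s t :
  wreg A B (s ++ t) <-> wreg A B s /\ wreg A (quot_by B A s) t.
Proof.
elim: s B => [|y s IH] B /=; first by split=> // -[].
split=> [[h /IH[h1 h2]]|[[h1 h2] h3]]; first by [].
by split=> //; apply/IH.
Qed.

(** The form matching [regular_sequence], which speaks of the prefixes [take i s]. *)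
Lemma wregP A B s : wreg A B s <->
  (forall i, (i < size s)%N -> forall a, A a ->
     quot_by B A (take i s) (s`_i *: a) -> quot_by B A (take i s) a).
Proof.
elim: s B => [|y s IH] B //=; split=> [[h /IH h'] [|i] ik|h] /=; first exact: h.
  exact: h'.
by split; [exact: (h 0%N) | apply/IH => i ik; apply: (h i.+1)].
Qed.

(** For [u] in [A] the component [b = u - y *: v] lies in [A] too, so only the trace of [B] on [A]
    matters. *)
Lemma add_scaled_local A B B' y u : is_submod A ->
  (forall a, A a -> B a -> B' a) ->
  A u -> add_scaled B y A u -> add_scaled B' y A u.
Proof.
move=> sA BB' Au [b [v [Bb Av uE]]]; exists b, v; split=> //; apply: BB' => //.
rewrite -[b](addrK (y *: v)) -uE; apply: submodB => //; exact: submodZ.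
Qed.

Lemma quot_by_local A B B' s u : is_submod A ->
  (forall a, A a -> B a -> B' a) -> A u -> quot_by B A s u -> quot_by B' A s u.
Proof.
move=> sA; elim: s B B' => [|y s IH] B B' BB' Au /=; first exact: BB'.
by apply: IH => // a Aa; apply: add_scaled_local.
Qed.

Lemma wreg_local A B B' s : is_submod A ->
  (forall a, A a -> B a <-> B' a) -> wreg A B s -> wreg A B' s.
Proof.
move=> sA; elim: s B B' => //= y s IH B B' BB' [h1 h2]; split=> [a Aa|].
  move/(BB' _ (submodZ _ sA Aa)) => /(h1 _ Aa); exact: (proj1 (BB' a Aa)).
apply: IH h2 => a Aa; split; apply: add_scaled_local => // b /BB' []//.
Qed.

(* [add_scaled B 1 C] is the sum [B + C]. *)
Lemma add_scaled_regular A B C y u : is_submod A -> is_submod C ->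
  (forall c, C c -> A c) ->
  (forall a, A a -> add_scaled B 1 C (y *: a) -> add_scaled B 1 C a) ->
  is_submod B -> C u -> add_scaled B y A u -> add_scaled B y C u.
Proof.
move=> sA sC CA hy sB Cu [b [a [Bb Aa uE]]].
(* Modulo [B + C] the product [y *: a] vanishes, so [a] is in [B + C] and may be replaced by its
   component in [C]. *)
have [|b' [c [Bb' Cc aE]]] := hy a Aa.
  exists (- b), u; split=> //; first exact: submodN.
  by rewrite uE scale1r addrC addrAC subrr add0r.
exists (b + y *: b'), c; split=> //.
  by apply: submodD => //; apply: submodZ.
by rewrite uE aE scale1r scalerDr addrA.
Qed.

Lemma add_scaled_sumC A B C y u :
  add_scaled (add_scaled B 1 C) y A u <-> add_scaled (add_scaled B y A) 1 C u.
Proof.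
split=> -[_ [a [[b [c [Bb Cc ->]]] Aa ->]]].
  by exists (b + y *: a), c; split=> //; [exists b, a | rewrite addrAC].
by exists (b + 1 *: a), c; split=> //; [exists b, a | rewrite addrAC].
Qed.

(** Regularity on [A/(B + C)] keeps [0 -> C/B -> A/B -> A/(B + C) -> 0] exact after division by
    [s]. *)
Lemma quot_by_regular A B C s u : is_submod A -> is_submod B -> is_submod C ->
  (forall c, C c -> A c) -> wreg A (add_scaled B 1 C) s ->
  C u -> quot_by B A s u -> quot_by B C s u.
Proof.
move=> sA + sC CA; elim: s B => //= y s IH B sB [h1 h2] Cu /IH h.
apply: (@quot_by_local _ (add_scaled B y A)) => //.
  by move=> a Ca; apply: add_scaled_regular.
apply: h => //; first exact: add_scaledP.
by apply: wreg_local h2 => // a _; apply: add_scaled_sumC.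
Qed.

(** An element regular on both outer terms of [0 -> C/B -> A/B -> A/(B + C) -> 0] is regular on the
    middle one; [add_scaled_regular] keeps the sequence exact modulo [y], so induction on [s] goes
    on. *)
Lemma wreg_extension A B C s : is_submod A -> is_submod B -> is_submod C ->
  (forall c, C c -> A c) ->
  wreg C B s -> wreg A (add_scaled B 1 C) s -> wreg A B s.
Proof.
move=> sA + sC CA; elim: s B => //= y s IH B sB [h1 h2] [h3 h4]; split=> [a Aa Ba|].
  have [b [c [Bb Cc aE]]] := h3 a Aa (add_scaledl _ sC Ba).
  rewrite scale1r in aE.
  rewrite aE; apply: submodD => //; apply: h1 => //.
  apply: (@submod_addr _ _ _ _ (y *: b)) => //; first exact: submodZ.
  by rewrite -scalerDr addrC -aE.
apply: IH; first exact: add_scaledP.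
  apply: wreg_local h2 => // c Cc; split; last exact: add_scaled_regular.
  by move=> [b [v [Bb Cv ->]]]; exists b, v; split=> //; apply: CA.
by apply: wreg_local h4 => // a _; apply: add_scaled_sumC.
Qed.

End RegularSequences.

(** * Weak regularity under an isomorphism of subquotients *)

Section RegularTransport.
Variables (R : comNzRingType) (L L' : lmodType R).

Lemma wreg_transport (phi : {linear L -> L'}) (A B : L -> Prop) (A' B' : L' -> Prop) s :
  is_submod A' -> is_submod B' -> is_submod B ->
  (forall a, A a -> A' (phi a)) ->
  (forall a', A' a' -> exists2 a, A a & B' (a' - phi a)) ->
  (forall a, A a -> B' (phi a) <-> B a) ->
  is_submod A ->
  wreg A B s -> wreg A' B' s.
Proof.
move=> sA' sB' sB phiA phi_onto phiB sA.
elim: s B B' sB sB' phi_onto phiB => //= y s IH B B' sB sB' phi_onto phiB [h1 h2].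
split=> [a' A'a' B'a'|].
  have [a Aa Baa] := phi_onto a' A'a'.
  rewrite -[a'](subrK (phi a)); apply: submodD => //; apply/phiB => //.
  apply: h1 => //; apply/phiB; first exact: submodZ.
  rewrite linearZZ -[y *: phi a](subKr (y *: a')) -scalerBr.
  by apply: submodB => //; apply: submodZ.
apply: IH h2; [exact: add_scaledP | exact: add_scaledP | |].
  move=> a' A'a'; have [a Aa Baa] := phi_onto a' A'a'.
  by exists a => //; apply: add_scaledl.
move=> a Aa; split=> [[b [v [Bb Av aE]]]|[b [v [Bb Av aE]]]].
  have [w Aw Bw] := phi_onto v Av.
  exists (a - y *: w), w; split=> //; last by rewrite subrK.
  apply/phiB; first by apply: submodB => //; apply: submodZ.
  rewrite linearB linearZZ aE -addrA -scalerBr; apply: submodD => //; exact: submodZ.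
exists (phi b), (phi v); split; [|exact: phiA|by rewrite aE linearD linearZ].
apply/phiB => //; rewrite -[b](addrK (y *: v)) -aE; apply: submodB => //.
exact: submodZ.
Qed.

End RegularTransport.

(** * Koszul homology and weakly regular sequences *)

Section KoszulRegular.
Variables (R : comNzRingType) (n : nat) (x : 'I_n -> R) (L : lmodType R).
Implicit Types (A B : L -> Prop) (s : seq R).

(** Above degree [n] everything vanishes, and each element of [s] lowers this bound by one through
    [kvanish_of_quotient]. *)
Lemma kvanish_of_wreg A B s i : is_submod A -> is_submod B ->
  (forall y, y \in s -> in_span x y) -> wreg A B s ->
  (n < i + size s)%N -> kvanish x A B i.
Proof.
move=> sA; elim: s B i => [|y s IH] B i sB xs /=.
  by rewrite addn0 => _; apply: kvanish_big.
move=> [h1 h2]; rewrite addnS -addSn => ni; apply: (@kvanish_of_quotient _ _ _ _ _ _ y) => //.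
  by apply: xs; rewrite inE eqxx.
by apply: IH => //; [exact: add_scaledP | move=> z zs; apply: xs; rewrite inE zs orbT].
Qed.

Lemma kvanish_quot_by A B s q : is_submod A -> is_submod B -> wreg A B s ->
  (forall i, (q < i)%N -> kvanish x A B i) ->
  forall i, (q + size s < i)%N -> kvanish x A (quot_by B A s) i.
Proof.
move=> sA; elim: s B q => [|y s IH] B q sB /=; first by rewrite addn0.
move=> [h1 h2] hv i; rewrite addnS -addSn; apply: IH => //; first exact: add_scaledP.
by case=> // j qj; apply: kvanish_quotient => //; apply: hv => //; apply: ltnW.
Qed.

End KoszulRegular.

(** * Monomial ideals *)

Section MonomialIdeals.
Variables (k : fieldType) (n : nat).
Local Notation R := {mpoly k[n]}.
Implicit Types (B : R^o -> Prop) (U V Delta : {set {set 'I_n}}) (F G : {set 'I_n}).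
Implicit Types (m : 'X_{1..n}).

Definition mvars m : {set 'I_n} := [set i | m i != 0%N].

(** For [U] the complement of a complex this is the Stanley-Reisner ideal, given by coefficients so
    that membership is tested monomial by monomial. [R^o] is the ring as a module over itself. *)
Definition face_ideal U : R^o -> Prop :=
  fun f => forall m, mvars m \notin U -> (f : R)@_m = 0.

Definition up_closed U : Prop := forall F G, F \in U -> F \subset G -> G \in U.

Definition down_closed Delta : Prop :=
  forall F G, F \in Delta -> G \subset F -> G \in Delta.

Lemma down_closedC Delta : down_closed Delta -> up_closed (~: Delta).
Proof. by move=> dD F G; rewrite !inE => FD FG; apply: contraNN FD => /dD; apply. Qed.

Lemma mvarsD m m' : mvars (m + m') = mvars m :|: mvars m'.
Proof. by apply/setP=> i; rewrite !inE mnmDE addn_eq0 negb_and. Qed.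

Lemma mvars_mesym1 F : mvars (mesym1 F) = F.
Proof. by apply/setP=> i; rewrite inE mnmE; case: (i \in F). Qed.

Lemma mvars1 (i : 'I_n) : mvars U_(i) = [set i].
Proof. by rewrite -mesym1_set1 mvars_mesym1. Qed.

Lemma face_idealX U m : mvars m \in U -> face_ideal U 'X_[m].
Proof.
by move=> mU m' m'U; rewrite mcoeffX; case: eqP m'U => // <-; rewrite mU.
Qed.

Lemma face_idealP U : up_closed U -> is_submod (face_ideal U).
Proof.
move=> upU; split=> [m _|a f g Uf Ug m mU]; first by rewrite mcoeff0.
rewrite mcoeffD Ug // addr0 -[a *: f]/(a * f) mcoeffM big1 // => p /eqP mE.
rewrite Uf ?mulr0 //; apply: contraNN mU => /upU; apply.
have -> : mvars m = mvars p.1 :|: mvars p.2 by rewrite -mvarsD -mE.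
exact: subsetUr.
Qed.

Lemma face_ideal_min U (B : R^o -> Prop) : is_submod B ->
  (forall m, mvars m \in U -> B 'X_[m]) -> forall f, face_ideal U f -> B f.
Proof.
move=> sB BX f Uf; rewrite [f]mpolyE big_seq; apply: (big_ind B).
- exact: submod0 sB.
- by move=> u v; apply: submodD sB.
move=> m mf; rewrite -mul_mpolyC -[_ * _]/(_ *: ('X_[m] : R^o)).
apply: submodZ => //; apply: BX; apply: contraTT mf => /Uf fm.
by rewrite mcoeff_msupp fm eqxx.
Qed.

Lemma mcoeffXM (f : R) m m' : ('X_[m] * f)@_(m + m') = f@_m'.
Proof. by rewrite mulrC mcoeffMX. Qed.

Lemma prodX_mesym1 F : \prod_(i in F) 'X_i = 'X_[mesym1 F] :> R.
Proof.
rewrite mpolyXE_id big_mkcond; apply: eq_bigr => i _; rewrite mnmE.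
by case: (i \in F).
Qed.

Lemma SR_idealP Delta f :
  down_closed Delta ->
  f \in @SR_ideal k n Delta <-> face_ideal (~: Delta) f.
Proof.
move=> /down_closedC up.
split=> [/asboolP[c ->]|].
  apply: (submod_sum (face_idealP up)) => N ND.
  rewrite -[_ * _]/(_ *: (_ : R^o)); apply: submodZ (face_idealP up) _.
  by rewrite prodX_mesym1; apply: face_idealX; rewrite mvars_mesym1 inE.
apply: (@face_ideal_min _ (fun f : R^o => (f : R) \in @SR_ideal k n Delta)).
  split=> [|a u v Bu Bv]; first exact: rpred0.
  by apply: rpredD => //; apply: SR_idealMl.
move=> m; rewrite inE => mD.
(* The monomial is a multiple of the squarefree product over its support, which is one of the
   generators. *)
have -> : 'X_[m] = 'X_[m - mesym1 (mvars m)] * \prod_(i in mvars m) 'X_i :> R.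
  rewrite prodX_mesym1 -mpolyXD submK //; apply/mnm_lepP => i.
  by rewrite mnmE inE; case: (m i).
apply: SR_idealMl; apply/asboolP; exists (fun N => (N == mvars m)%:R).
rewrite [RHS](bigD1 (mvars m)) //= eqxx mul1r.
rewrite [X in _ + X]big1 ?addr0 // => N /andP[_ /negbTE->].
by rewrite mul0r.
Qed.

(* [face_ideal (prime_family F)] is generated by the variables outside of [F]. *)
Definition prime_family F : {set {set 'I_n}} := [set G : {set 'I_n} | ~~ (G \subset F)].

Lemma prime_family_up F : up_closed (prime_family F).
Proof.
move=> G G'; rewrite !inE => GF /subset_trans h.
by apply: contraNN GF; apply: h.
Qed.

Lemma prime_idealP F : is_submod (face_ideal (prime_family F)).
Proof. exact/face_idealP/prime_family_up. Qed.

Lemma prime_ideal_addX F v f : v \in F ->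
  add_scaled (face_ideal (prime_family F)) 'X_v full_submod f <->
  face_ideal (prime_family (F :\ v)) f.
Proof.
move=> vF; split=> [[b [a [Bb _ ->]]]|].
  apply: (submodD (prime_idealP _)).
    move=> m; rewrite inE negbK => mF; apply: Bb; rewrite inE negbK.
    exact: subset_trans mF (subD1set _ _).
  rewrite -[_ *: _]/(_ * _) mulrC -[_ * _]/(_ *: ('X_v : R^o)).
  apply: (submodZ _ (prime_idealP _)).
  by apply: face_idealX; rewrite mvars1 inE sub1set !inE eqxx.
apply: face_ideal_min => [|m]; first by apply: add_scaledP => //; exact: prime_idealP.
rewrite inE subsetD1 negb_and negbK inE; have [mv _|/eqP mv] := boolP (m v != 0%N).
  rewrite (_ : 'X_[m] = 'X_v * 'X_[m - U_(v)]); last first.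
    rewrite -mpolyXD addmC submK //; apply/mnm_lepP => i; rewrite mnm1E.
    by case: eqP => // <-; rewrite lt0n.
  by apply: add_scaledr => //; exact: prime_idealP.
by rewrite orbF => mF; apply: add_scaledl => //; apply: face_idealX; rewrite inE.
Qed.

Lemma prime_ideal_X_regular F v (f : R^o) : v \in F ->
  face_ideal (prime_family F) ('X_v *: f) -> face_ideal (prime_family F) f.
Proof.
move=> vF h m; rewrite inE negbK => mF.
rewrite -(mcoeffXM f U_(v)%MM m); apply: h.
by rewrite inE negbK mvarsD mvars1 subUset sub1set vF mF.
Qed.

(** * Homogeneous ideals *)

Lemma mcoeff_pihomog j (f : R) m :
  (pihomog mdeg j f)@_m = if mdeg m == j then f@_m else 0.
Proof.
rewrite pihomogE raddf_sum /= (eq_bigr (fun i => (f@_i * (i == m)%:R))); last first.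
  by move=> i _; rewrite mcoeffZ mcoeffX.
have [mf|mf] := boolP (m \in msupp f); last first.
  rewrite (memN_msupp_eq0 mf) if_same big_seq_cond big1 // => i /andP[im _].
  by case: eqP im mf => [->->|]; rewrite ?mulr0.
case: ifP => mj.
  rewrite -big_filter (bigD1_seq m) /= ?mem_filter ?mj ?mf ?filter_uniq ?msupp_uniq //.
  by rewrite eqxx mulr1 big1 ?addr0 // => i /negbTE->; rewrite mulr0.
rewrite big1 // => i /eqP ij; case: eqP => [im|]; last by rewrite mulr0.
by rewrite -im ij eqxx in mj.
Qed.

Lemma pihomogM e j (t f : R) : t \is e.-homog ->
  pihomog mdeg j (t * f) = if (e <= j)%N then t * pihomog mdeg (j - e) f else 0.
Proof.
move=> te; have hm d : t * pihomog mdeg d f \is (e + d).-homog.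
  by apply: dhomogM => //; apply: pihomogP.
(* [N] bounds the degrees occurring in [f] and exceeds [j - e], so that this index occurs in the
   sum. *)
pose N := maxn (msize f) j.+1.
rewrite {1}(@pihomog_partitionE n k mdeg N f) ?leq_maxl //.
rewrite mulr_sumr raddf_sum /=; case: ifP => ej.
  have jN : (j - e < N)%N by rewrite leq_max ltnS leq_subr orbT.
  rewrite (bigD1 (Ordinal jN)) //= pihomog_dE; last first.
    by have := hm (j - e)%N; rewrite subnKC.
  rewrite big1 ?addr0 // => d dj; apply: pihomog_ne0 (hm d).
  by apply: contraNneq dj => dE; apply/eqP/val_inj => /=; lia.
by rewrite big1 // => d _; apply: pihomog_ne0 (hm d); lia.
Qed.

Definition homog_submod (B : R^o -> Prop) : Prop :=
  is_submod B /\ forall j f, B f -> B (pihomog mdeg j f).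

Lemma face_ideal_homog U : up_closed U -> homog_submod (face_ideal U).
Proof.
move=> upU; split=> [|j f Uf m mU]; first exact: face_idealP.
by rewrite mcoeff_pihomog Uf // if_same.
Qed.

Lemma add_scaled_homog B e t :
  t \is e.-homog -> homog_submod B -> homog_submod (add_scaled B t full_submod).
Proof.
move=> te [sB hB].
have sB' : is_submod (add_scaled B t full_submod) by exact: add_scaledP.
split=> // j f [b [a [Bb _ ->]]].
rewrite raddfD /= -[_ *: _]/(_ * _) (pihomogM _ _ te); apply: (submodD sB').
  by apply: add_scaledl => //; apply: hB.
case: ifP => _; last exact: submod0 sB'.
exact: (@add_scaledr _ _ B t full_submod).
Qed.

Lemma homog_submod_ext B (f : R) :
  is_submod B -> (forall j, B (pihomog mdeg j f)) -> B f.
Proof.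
move=> sB h; rewrite (@pihomog_partitionE n k mdeg (msize f) f) //.
by apply: (@submod_sum _ _ B).
Qed.

(** If [t f] is in [B] then [f = b + y a], so [y (t a)], hence [t a], is in [B]. For homogeneous [f]
    the cofactor [a] can be taken of smaller degree, because [y] has positive degree; induction on
    the degree concludes. *)
Lemma regular_of_quotient B (y t : R) d e : homog_submod B ->
  y \is d.+1.-homog -> t \is e.-homog ->
  (forall f, B (y *: f) -> B f) ->
  (forall f, add_scaled B y full_submod (t *: f) -> add_scaled B y full_submod f) ->
  forall f, B (t *: f) -> B f.
Proof.
move=> [sB hB] yd te yreg treg f Btf; apply: homog_submod_ext => // j.
have {Btf} : B (t *: (pihomog mdeg j f : R^o)).
  by have := hB (j + e)%N _ Btf; rewrite (pihomogM _ _ te) leq_addl addnK.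
move: (pihomogP mdeg j f); move: (pihomog mdeg j f) => {}f fj.
have [N jN] := ubnP j; elim: N => // N IH in j jN f fj * => Btf.
have [b [a [Bb _ fE]]] := treg f (add_scaledl y (full_submodP _) Btf).
have {}fE : f = pihomog mdeg j b + pihomog mdeg j (y * a).
  by rewrite -[LHS](pihomog_dE fj) fE raddfD.
rewrite (pihomogM _ _ yd) in fE; case: ifP fE => dj fE; rewrite fE; last first.
  by rewrite addr0; apply: hB.
apply: (@submodD _ _ B) => //; first exact: hB.
apply: (@submodZ _ _ B y _ sB); apply: (IH (j - d.+1)%N); first by lia.
  exact: pihomogP.
apply: yreg; rewrite scalerA mulrC -scalerA.
have -> : y *: (pihomog mdeg (j - d.+1) a : R^o) = f - pihomog mdeg j b.
  by rewrite fE addrC addKr.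
by rewrite scalerBr; apply: submodB => //; apply: submodZ => //; apply: hB.
Qed.

(** Moves [y] from the front of a sequence to its end, past one entry at a time. The entry that is
    passed stays regular by [regular_of_quotient], which relies on homogeneity. *)
Lemma wreg_permute B (y : R) d (s : seq R) : homog_submod B -> y \is d.+1.-homog ->
  (forall t, t \in s -> exists e, t \is e.-homog) ->
  (forall f, B (y *: f) -> B f) ->
  wreg full_submod (add_scaled B y full_submod) s ->
  wreg full_submod B s /\
  (forall f, quot_by B full_submod s (y *: f) -> quot_by B full_submod s f).
Proof.
move=> + yd; elim: s B => //= t s IH B hB hs yreg [h1 h2].
have [e te] := hs t (mem_head _ _).
have treg := regular_of_quotient hB yd te yreg (fun f => h1 f I).
have [||||w1 w2] := IH (add_scaled B t full_submod).
- exact: add_scaled_homog te hB.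
- by move=> z zs; apply: hs; rewrite inE zs orbT.
(* If [y f = b + t c], then regularity of [t] modulo [y] gives [c = b' + y c'], and [y (f - t c')]
   lies in [B]. *)
- move=> f [b [c [Bb _ fE]]].
  have [|b' [c' [Bb' _ cE]]] := h1 c I.
    by exists (- b), f; split=> //; [apply: submodN => //; case: hB|rewrite fE addKr].
  exists (f - t *: c'), c'; split=> //; last by rewrite subrK.
  apply: yreg; rewrite scalerBr fE cE scalerDr !scalerA [y * t]mulrC addrA addrK.
  by apply: submodD => //; [case: hB | apply: submodZ => //; case: hB].
- apply: wreg_local h2 => // f _.
  split=> -[_ [a [[b [c [Bb _ ->]]] _ ->]]].
    by exists (b + t *: a), c; split=> //; [exists b, a | rewrite addrAC].
  by exists (b + y *: a), c; split=> //; [exists b, a | rewrite addrAC].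
split; last by [].
by split=> // f _; apply: treg.
Qed.

End MonomialIdeals.

(** * Elementary symmetric polynomials *)

Section ElementarySymmetric.
Variables (k : fieldType) (n : nat).
Local Notation R := {mpoly k[n]}.
Local Notation var := (fun i : 'I_n => 'X_i : R).
Implicit Types (B D : R^o -> Prop) (U N : {set {set 'I_n}}) (F G : {set 'I_n}).
Implicit Types (m : 'X_{1..n}) (f g : R^o).

Definition esyms r : seq R := [seq mesym n k i | i <- iota 1 r].

Lemma esymsS r : esyms r.+1 = rcons (esyms r) (mesym n k r.+1).
Proof. by rewrite /esyms -[in LHS](addn1 r) iotaD map_cat cats1 add1n. Qed.

Lemma size_esyms r : size (esyms r) = r.
Proof. by rewrite size_map size_iota. Qed.

Lemma mem_esyms r y : y \in esyms r -> exists2 j, (0 < j <= r)%N & y = mesym n k j.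
Proof.
by case/mapP=> j; rewrite mem_iota add1n ltnS => jr ->; exists j.
Qed.

Lemma in_span_var (f : R) : f@_0%MM = 0 -> in_span var f.
Proof.
move=> f0; rewrite [f]mpolyE big_seq; apply: (big_ind (in_span var)).
- by exists (fun=> 0); rewrite big1 // => v _; rewrite mul0r.
- move=> _ _ [a ->] [b ->]; exists (fun v => a v + b v).
  by rewrite -big_split; apply: eq_bigr => v _; rewrite mulrDl.
move=> m mf; have /existsP[i mi] : [exists i, m i != 0%N].
  rewrite -negb_forall; apply/negP => /forallP m0.
  have mE : m = 0%MM by apply/mnmP => i; rewrite mnmE; apply/eqP.
  by move: mf; rewrite mcoeff_msupp mE f0 eqxx.
exists (fun v => (v == i)%:R * (f@_m *: 'X_[m - U_(i)])).
rewrite (bigD1 i) //= eqxx mul1r big1 => [|v /negbTE->]; last by rewrite !mul0r.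
rewrite addr0 -scalerAl -mpolyXD submK //; apply/mnm_lepP => v; rewrite mnm1E.
by case: eqP => // <-; rewrite lt0n.
Qed.

Lemma mcoeff0_mesym j : (0 < j)%N -> (mesym n k j)@_0%MM = 0.
Proof. by move=> j0; rewrite mcoeff_mesym /mechar mdeg0 eq_sym gtn_eqF. Qed.

Lemma in_span_esyms r y : y \in esyms r -> in_span var y.
Proof.
by case/mem_esyms=> j /andP[j0 _] ->; apply/in_span_var/mcoeff0_mesym.
Qed.

(** Any other set of [#|F|] variables contains one outside of [F]. *)
Lemma mesym_prime_ideal F : face_ideal (prime_family F)
  (mesym n k #|F| - \prod_(i in F) 'X_i).
Proof.
rewrite mesymE (bigD1 F) //= prodX_mesym1 addrAC subrr add0r.
apply: (submod_sum (prime_idealP k _)) => G /andP[GF neGF].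
apply: face_idealX; rewrite mvars_mesym1 inE.
by apply: contraNN neGF => sGF; rewrite eqEcard sGF (eqP GF) leqnn.
Qed.

(** Induction on [#|F|]. Killing a variable [x_v] with [v] in [F] and moving it to the end ([key])
    settles fewer than [#|F|] elements, and shows that [x_v] is regular modulo them. The last one,
    [e_#|F|], is congruent to the product of these variables. *)
Lemma simplex_regular F r : (r <= #|F|)%N ->
  wreg full_submod (face_ideal (prime_family F)) (esyms r).
Proof.
have [N] := ubnP #|F|; elim: N => // N IH in F r *; rewrite ltnS => FN rF.
have key v r' : v \in F -> (r' < #|F|)%N ->
    wreg full_submod (face_ideal (prime_family F)) (esyms r') /\
    (forall f, quot_by (face_ideal (prime_family F)) full_submod (esyms r') ('X_v *: f) ->
       quot_by (face_ideal (prime_family F)) full_submod (esyms r') f).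
  move=> vF r'F; apply: (@wreg_permute _ _ _ 'X_v 0).
  - exact/face_ideal_homog/prime_family_up.
  - by rewrite dhomogX; apply/eqP; exact: mdeg1.
  - by move=> _ /mem_esyms[j _ ->]; exists j; apply: dhomog_mesym.
  - by move=> f; apply: prime_ideal_X_regular.
  apply: (@wreg_local _ _ _ (face_ideal (prime_family (F :\ v)))) => //.
    by move=> f _; split=> /(prime_ideal_addX _ vF).
  by apply: IH; move: FN r'F; rewrite (cardsD1 v F) vF; lia.
case: r rF => [|r] // rF.
have [v vF] : exists v, v \in F by apply/card_gt0P; lia.
move: rF; rewrite leq_eqVlt => /orP[/eqP rF|]; last by case/(key v) => //.
rewrite esymsS -cats1; apply/wreg_cat.
have [w _] := key v r vF (eq_leq rF); split=> //; split=> // f _.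
set Q := quot_by _ _ _ => Qf.
have sQ : is_submod Q by apply: quot_by_submod => //; exact: prime_idealP.
have {Qf} : Q ((\prod_(i in F) 'X_i) *: f).
  rewrite -[X in X *: f](subKr (mesym n k #|F|)) scalerBl -rF; apply: submodB => //.
  apply: quot_by_incl => //; rewrite rF -[_ *: _]/(_ * _) mulrC -[_ * _]/(_ *: (_ : R^o)).
  exact: (submodZ _ (prime_idealP k _) (@mesym_prime_ideal F)).
pose P (y : R) := forall f, Q (y *: f) -> Q f.
suff : P (\prod_(i in F) 'X_i) by apply.
apply: (big_ind P) => [g|y z Py Pz g|i iF g]; first by rewrite scale1r.
  by rewrite -scalerA => /Py/Pz.
by case: (key i r iF (eq_leq rF)) => _; apply.
Qed.

Lemma wreg_trivial (A B : R^o -> Prop) s : is_submod A ->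
  (forall f, A f -> B f) -> wreg A B s.
Proof.
move=> sA; elim: s B => //= y s IH B AB; split=> [f Af _|]; first exact: AB.
by apply: IH => f Af; apply: add_scaledl => //; apply: AB.
Qed.

(* Filter [face_ideal U] modulo [face_ideal N] with one graded piece
   [x_F k[x_i, i in F]] for each [F] in [U :\: N]. *)
Lemma layer_regular N U r : up_closed N -> up_closed U -> N \subset U ->
  (forall F, F \in U :\: N -> (r <= #|F|)%N) ->
  wreg (face_ideal U) (face_ideal N) (esyms r).
Proof.
move=> upN; have [l] := ubnP #|U :\: N|; elim: l => // l IH in U *.
rewrite ltnS => Ul upU NU rU.
have [UN|[F0 F0U]] := set_0Vmem (U :\: N).
  apply: wreg_trivial => [|f Uf m mN]; first exact: face_idealP.
  by apply: Uf; apply: contraNN mN => mU; apply: contraT => mN;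
    rewrite -(in_set0 (mvars m)) -UN inE mN.
(* A smallest set of [U :\: N] is minimal for inclusion in [U], because [N] is up-closed; removing
   it leaves an up-closed family. *)
case: (@arg_minnP _ F0 (mem (U :\: N)) (fun F : {set 'I_n} => #|F|) F0U)
  => F /setDP[FU FN] Fmin {F0 F0U}.
have Fmin' G : G \in U -> G \subset F -> G = F.
  move=> GU GF; apply/eqP; rewrite eqEcard GF; apply: Fmin; apply/setDP; split=> //.
  by apply: contraNN FN => /upN; apply.
pose U' := U :\ F.
have upU' : up_closed U'.
  move=> G G'; rewrite !inE => /andP[GF GU] GG'; rewrite (upU G) // andbT.
  by apply: contraNneq GF => G'F; rewrite G'F in GG'; rewrite (Fmin' G).
have NU' : N \subset U'.
  apply/subsetP=> G GN; rewrite !inE (subsetP NU) // andbT.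
  by apply: contraNneq FN => <-.
have CA f : face_ideal U' f -> face_ideal U f.
  by move=> U'f m mU; apply: U'f; rewrite !inE negb_and mU orbT.
have sU := face_idealP k upU; have sU' := face_idealP k upU'.
have sN := face_idealP k upN.
apply: (@wreg_extension _ _ _ _ (face_ideal U')) => //.
  apply: IH => //; last first.
    by move=> G; rewrite !inE => /and3P[GN GF GU]; apply: rU; rewrite inE GN.
  apply: leq_trans Ul; apply: proper_card.
  apply/properP; split; last by exists F; rewrite !inE ?FN ?FU ?eqxx.
  by apply/subsetP=> G; rewrite !inE => /and3P[-> _ ->].
(* Multiplication by [x_F] identifies the polynomial ring on [F] with [face_ideal U] modulo
   [face_ideal U']. *)
pose xF := 'X_[mesym1 F] \*: idfun : {linear R^o -> R^o}.
have [FU' XE] : face_ideal U ('X_[mesym1 F] : R) /\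
    forall f, xF f = f * 'X_[mesym1 F] :> R.
  by split=> [|f]; [apply: face_idealX; rewrite mvars_mesym1 | rewrite /= mulrC].
apply: (@wreg_local _ _ _ (face_ideal U')) => //.
  move=> f _; split=> [U'f|[b [c [Nb U'c ->]]]].
    by exists 0, f; split=> //; [exact: submod0 sN | rewrite scale1r add0r].
  rewrite scale1r; apply: (submodD sU') => // m mU'; apply: Nb.
  by apply: contraNN mU' => /(subsetP NU').
apply: (@wreg_transport _ _ _ xF full_submod
  (face_ideal (prime_family F)) (face_ideal U) (face_ideal U')) => //.
- exact: prime_idealP.
- by move=> f _; rewrite XE -[_ * _]/(_ *: (_ : R^o)); exact: (submodZ _ sU FU').
- move=> f; apply: (face_ideal_min (B := fun f : R^o => exists2 a : R^o, full_submod a &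
      face_ideal U' (f - xF a))) f.
    split=> [|a u v [u' _ Bu] [v' _ Bv]].
      by exists 0 => //; rewrite linear0 subr0; exact: submod0 sU'.
    exists (a *: u' + v') => //; rewrite linearP opprD addrACA -scalerBr.
    exact: (proj2 sU').
  move=> m mU; have [mF|mF] := eqVneq (mvars m) F; last first.
    exists 0 => //; rewrite linear0 subr0; apply: face_idealX.
    by rewrite !inE mF mU.
  exists 'X_[m - mesym1 F] => //; rewrite XE -mpolyXD submK; last first.
    by apply/mnm_lepP => i; rewrite mnmE -mF inE; case: (m i).
  by rewrite subrr; exact: submod0 sU'.
- move=> f _; split.
    move=> U'f m; rewrite inE negbK => mF.
    rewrite -(mcoeffXM f (mesym1 F) m); apply: U'f.
    by rewrite mvarsD mvars_mesym1 (setUidPl mF) !inE eqxx.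
  apply: (face_ideal_min (B := fun f : R^o => face_ideal U' (xF f))) f.
    split=> [|a u v Bu Bv]; first by rewrite linear0; exact: submod0 sU'.
    by rewrite linearP; apply: (proj2 sU').
  move=> m; rewrite inE => mF; rewrite XE -mpolyXD; apply: face_idealX.
  rewrite mvarsD mvars_mesym1 !inE (upU F) ?subsetUr ?andbT //.
  by apply: contraNneq mF => <-; apply: subsetUl.
by apply: simplex_regular; apply: rU; rewrite inE FN.
Qed.

(** The variable [x_i] is a root of the monic polynomial with roots [x_1, ..., x_n], whose other
    coefficients are the elementary symmetric polynomials up to sign. *)
Lemma mesym_roots (i : 'I_n) : exists a : 'I_n -> R,
  'X_i ^+ n = \sum_(j < n) mesym n k j.+1 * a j.
Proof.
pose cs := [tuple ('X_j : R) | j < n]; pose P := \prod_(c <- cs) ('X - c%:P).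
have sP : size P = n.+1 by rewrite size_prod_XsubC size_tuple.
have P0 : P.[('X_i : R)] = 0.
  by apply/rootP; rewrite root_prod_XsubC; apply/tnthP; exists i; rewrite tnth_mktuple.
have PE j : (j <= n)%N -> P`_(n - j) = (-1) ^+ j * mesym n k j.
  move=> jn; rewrite (mroots_coeff cs (Ordinal (jn : (j < n.+1)%N))) /=; congr (_ * _).
  rewrite /mesym rmorph_sum; apply: eq_bigr => h _; rewrite rmorph_prod.
  by apply: eq_bigr => v _; rewrite /= mevalXU tnth_mktuple.
exists (fun j => - ((-1) ^+ j.+1 * 'X_i ^+ (n - j.+1))).
move: P0; rewrite horner_coef sP big_ord_recr /= => /eqP; rewrite addrC addr_eq0.
have := PE 0%N (leq0n n); rewrite subn0 expr0 mesym0E mul1r => ->; rewrite mul1r => /eqP->.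
rewrite -sumrN (reindex_inj rev_ord_inj); apply: eq_bigr => j _ /=.
rewrite PE; last exact: ltn_ord.
by rewrite mulrN; congr (- _); ring.
Qed.

(** The top Koszul homology is the socle: a chain supported on [setT] is a cycle when all variables
    kill it, and nothing bounds it. *)
Lemma socle_kvanish D : is_submod D -> kvanish var full_submod D n ->
  forall f, (forall i : 'I_n, D ('X_i *: f)) -> D f.
Proof.
move=> sD hv f Df.
have [|T Tn|b _ bE] := hv (fun S => if S == setT then f else 0); first by [].
  apply: submod_sum => // v vT; case: ifP => _; last by rewrite scaler0; exact: submod0.
  by rewrite -scalerA; apply: submodZ.
have := bE setT; rewrite eqxx cardsT card_ord => /(_ erefl).
by rewrite /kdiff big1 ?subr0 // => v; rewrite inE.
Qed.

(** A monomial of degree at least [n * n] has an exponent at least [n], hence sends [f] into [D];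
    the socle statement then lowers the degree down to [0]. *)
Lemma socle_kvanish_powers D f : (0 < n)%N -> is_submod D ->
  kvanish var full_submod D n ->
  (forall i : 'I_n, D ('X_i ^+ n *: f)) -> D f.
Proof.
move=> n0 sD hv Df.
suff h (t : nat) m : (n * n <= mdeg m + t)%N -> D ('X_[m] *: f).
  by rewrite -[f]scale1r -mpolyX0; apply: (h (n * n)%N); rewrite mdeg0.
elim: t m => [|t IH] m; last first.
  move=> mt; apply: socle_kvanish => // i; rewrite scalerA -mpolyXD; apply: IH.
  by rewrite mdegD mdeg1 add1n addSnnS.
rewrite addn0 => mt.
have [i mi] : exists i, (n <= m i)%N.
  apply: contrapT => /forallNP h; move: mt; rewrite leqNgt => /negP; apply.
  apply: (@leq_ltn_trans (n * n.-1)); last by rewrite ltn_pmul2l // prednK.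
  rewrite mdegE -[X in (_ <= X * _)%N]card_ord -sum_nat_const; apply: leq_sum => i _.
  by rewrite -ltnS prednK // ltnNge; apply/negP/h.
have -> : 'X_[m] = 'X_[m - U_(i) *+ n] * 'X_i ^+ n :> R.
  rewrite mpolyXn -mpolyXD submK //; apply/mnm_lepP => v; rewrite mulmnE mnm1E.
  by case: eqP => [<-|]; rewrite ?mul1n ?mul0n.
by rewrite -scalerA; apply: submodZ.
Qed.

(* The depth of a Stanley-Reisner ring is attained by an initial segment of the
   elementary symmetric polynomials. *)
Lemma esyms_regular N r : up_closed N -> (r <= n)%N ->
  (forall i, (n < i + r)%N -> kvanish var full_submod (face_ideal N) i) ->
  wreg full_submod (face_ideal N) (esyms r).
Proof.
(* The sets outside [U] are the faces with at most [r] elements, a skeleton of the complex. *)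
elim: r N => // r IH N upN rn hv; pose U := N :|: [set F : {set 'I_n} | (r < #|F|)%N].
have upU : up_closed U.
  move=> F G; rewrite !inE => /orP[FN FG|rF FG]; first by rewrite (upN F).
  by rewrite (leq_trans rF) ?subset_leq_card ?orbT.
have sR := full_submodP (R^o).
set I := face_ideal N in hv *; pose C := face_ideal (k := k) U.
have sI : is_submod I := face_idealP k upN; have sC : is_submod C := face_idealP k upU.
have IC f : I f -> C f by move=> h m; rewrite inE negb_or => /andP[/h].
have wC : wreg C I (esyms r.+1).
  apply: layer_regular => //; first exact: subsetUl.
  by move=> F; rewrite !inE; case: (F \in N).
have hC i : (n < i + r.+1)%N -> kvanish var C I i.
  move=> ni; apply: (kvanish_of_wreg (s := esyms r.+1)) => //; last by rewrite size_esyms.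
  by move=> y /in_span_esyms.
(* This follows from [H_i (R/I) = 0] and [H_(i-1) (C/I) = 0], and lets the induction hypothesis
   apply to the skeleton. *)
have hRC i : (n < i + r)%N -> kvanish var full_submod C i.
  case: i => [|i] ni; first by lia.
  by apply: (@kvanish_ses _ _ _ _ _ I) => //; [apply: hv; lia | apply: hC; lia].
have wRC := IH U upU (ltnW rn) hRC.
have wC' : wreg C I (esyms r) by move: wC; rewrite esymsS -cats1 => /wreg_cat[].
have wRC' : wreg full_submod (add_scaled I 1 C) (esyms r).
  apply: wreg_local wRC => // f _; split=> [Cf|[b [c [Ib Cc ->]]]].
    by exists 0, f; split=> //; [exact: submod0 sI | rewrite scale1r add0r].
  by rewrite scale1r; apply: (submodD sC) => //; apply: IC.
have wR : wreg full_submod I (esyms r) by exact: (@wreg_extension _ _ full_submod I C).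
rewrite esymsS -cats1; apply/wreg_cat; split=> //; split=> // f _.
set Q := quot_by _ _ _; set e := mesym n k r.+1 => Qef.
have sQ : is_submod Q by apply: quot_by_submod.
have IQ g : I g -> Q g by apply: quot_by_incl.
have n0 : (0 < n)%N by apply: leq_ltn_trans rn.
(* Dividing by [r] elements moves the vanishing range to degrees above [n - 1], so [H_n] of [R/Q]
   vanishes and it suffices to treat the multiples [x_i ^ n f]. *)
apply: socle_kvanish_powers => //.
  apply: (kvanish_quot_by (q := (n - r.+1)%N)) => //; last by rewrite size_esyms; lia.
  by move=> i ni; apply: hv; lia.
(* [D] is [Q + C]. It contains the multiples of every [e_j] with [j > 0]: those with [j <= r] are in
   [Q], and the monomials of the others involve more than [r] variables. By [mesym_roots] it
   contains [x_i ^ n f]. *)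
move=> i; pose D g := exists2 c, C c & Q (g - c).
have sD : is_submod D.
  split=> [|a u v [c Cc Qc] [c' Cc' Qc']].
    by exists 0; [exact: submod0 | rewrite subr0; exact: submod0].
  exists (a *: c + c'); first exact: (proj2 sC).
  by rewrite opprD addrACA -scalerBr; apply: (proj2 sQ).
have De j g : D (mesym n k j.+1 *: g).
  have [jr|jr] := leqP r j.
    exists (mesym n k j.+1 *: g); last by rewrite subrr; exact: submod0.
    rewrite -[_ *: _]/(_ * _) mulrC -[_ * _]/(_ *: (_ : R^o)); apply: (submodZ _ sC).
    rewrite mesymE; apply: (submod_sum sC) => h /eqP hj; apply: face_idealX.
    by rewrite mvars_mesym1 !inE hj ltnS jr orbT.
  exists 0; [exact: submod0 | rewrite subr0; apply: quot_by_mem => //].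
  by apply/mapP; exists j.+1 => //; rewrite mem_iota; lia.
have [c Cc Qc] : D ('X_i ^+ n *: f).
  have [a ->] := mesym_roots i; rewrite scaler_suml; apply: submod_sum => // j _.
  by rewrite -scalerA.
rewrite -[_ *: f](subrK c); apply: submodD => //.
have {Qef} Qec : Q (e *: c).
  rewrite -[c](subKr ('X_i ^+ n *: f)) scalerBr; apply: submodB => //; last exact: submodZ.
  by rewrite scalerA mulrC -scalerA; apply: submodZ.
(* Regularity on [R/C] brings [e *: c] into [I + (e_1, ..., e_r) C], where [e] can be cancelled by
   its regularity on [C]. *)
have {}Qec : quot_by I C (esyms r) (e *: c).
  apply: (quot_by_regular sR sI sC _ wRC' _ Qec) => //; exact: (submodZ _ sC).
move: wC; rewrite esymsS -cats1 => /wreg_cat[_ [/(_ c Cc Qec) h _]].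
apply: quot_by_min h => // y v yr _; exact: quot_by_mem.
Qed.

End ElementarySymmetric.

(** * Koszul homology of projective modules *)

Section Projective.
Variables (k : fieldType) (n : nat).
Local Notation R := {mpoly k[n]}.
Local Notation var := (fun i : 'I_n => 'X_i : R).

Lemma vars_regular (F : {set 'I_n}) (s : seq 'I_n) : uniq s -> {subset s <= F} ->
  wreg full_submod (face_ideal (k := k) (prime_family F)) [seq 'X_i | i <- s].
Proof.
elim: s F => //= i s IH F /andP[i_s us] sF.
have iF : i \in F by apply: sF; rewrite inE eqxx.
split=> [f _|]; first exact: prime_ideal_X_regular.
apply: (@wreg_local _ _ _ (face_ideal (prime_family (F :\ i)))) => //.
  by move=> f _; split=> /(prime_ideal_addX _ iF).
apply: IH => // j js; rewrite !inE sF ?andbT; last by rewrite inE js orbT.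
by apply: contraNneq i_s => <-.
Qed.

Lemma kvanish_poly i : (0 < i)%N ->
  kvanish var (full_submod (L := R^o)) null_submod i.
Proof.
move=> i0; apply: (kvanish_of_wreg (s := [seq 'X_i | i <- enum 'I_n])) => //.
- exact: null_submodP.
- by move=> _ /mapP[j _ ->]; apply: in_span_var; rewrite mcoeffX mnm1_eq0.
- apply: wreg_local (vars_regular (enum_uniq _) (F := setT) _) => //.
    move=> f _; split=> [h|-> m _]; last by rewrite mcoeff0.
    by apply/mpolyP => m; rewrite mcoeff0; apply: h; rewrite inE subsetT.
  by move=> j; rewrite inE.
by rewrite size_map size_enum_ord; lia.
Qed.

(** Exactness is checked on each coordinate. The chain [c] involves finitely many basis elements,
    listed in [l]; restricting to them makes the bounding chain finitely supported. *)
Lemma kvanish_malg (K : choiceType) i : (0 < i)%N ->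
  kvanish var (full_submod (L := monalg.malg K R)) null_submod i.
Proof.
move=> i0 c _ cE.
have coefE (b : {set 'I_n} -> monalg.malg K R) S x :
    monalg.mcoeff x (kdiff var b S) =
    kdiff var (fun T => monalg.mcoeff x (b T) : R^o) S.
  by rewrite raddf_sum; apply: eq_bigr => v _; rewrite /= monalg.mcoeffZ.
have /choice[b bE] (x : K) : exists b : {set 'I_n} -> R^o,
    forall S : {set 'I_n}, #|S| = i ->
    monalg.mcoeff x (c S) = kdiff var b S.
  have [//|T Ti|b _ bE] := @kvanish_poly i i0 (fun T => monalg.mcoeff x (c T) : R^o).
    by rewrite -coefE (cE T Ti) monalg.mcoeff0.
  by exists b => S Si; apply/eqP; rewrite -subr_eq0; apply/eqP/bE.
pose l := undup (flatten [seq (monalg.msupp (c T) : seq K) | T : {set 'I_n}]).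
exists (fun S => \sum_(x <- l) monalg.mkmalgU x (b x S : R)) => // S Si.
apply/monalg.malgP => x; rewrite monalg.mcoeffB monalg.mcoeff0 coefE.
have lE T : monalg.mcoeff x (\sum_(y <- l) monalg.mkmalgU y (b y T : R)) =
    if x \in l then b x T else 0.
  rewrite raddf_sum /=; have [xl|xl] := boolP (x \in l).
    rewrite (bigD1_seq x) ?undup_uniq //= monalg.mcoeffUU big1 ?addr0 // => y.
    by rewrite monalg.mcoeffU => /negbTE->.
  rewrite big_seq big1 // => y yl; rewrite monalg.mcoeffU.
  by case: eqP xl => // <-; rewrite yl.
have [xl|xl] := boolP (x \in l).
  rewrite (bE x S Si) (@eq_kdiff _ _ _ _ _ (b x)) ?subrr // => T _.
  by rewrite lE xl.
rewrite (@eq_kdiff _ _ _ _ _ (fun=> 0)) => [|T _]; last by rewrite lE (negbTE xl).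
rewrite /kdiff big1 ?subr0 => [|v _]; last by rewrite scaler0.
apply/eqP; apply: contraNT xl => cx; rewrite mem_undup; apply/flattenP.
exists (monalg.msupp (c S) : seq K); last by rewrite -[_ \in _]monalg.mcoeff_neq0.
by apply/mapP; exists S => //; rewrite mem_enum.
Qed.

Lemma kvanish_retract (L P : lmodType R) (h : {linear P -> L}) (g : {linear L -> P}) i :
  (forall y, g (h y) = y) ->
  kvanish var (full_submod (L := L)) null_submod i ->
  kvanish var (full_submod (L := P)) null_submod i.
Proof.
move=> gh hv c _ cE; have [//|T Ti|b _ bE] := hv (fun S => h (c S)).
  by rewrite /null_submod kdiff_linear (cE T Ti) linear0.
exists (fun S => g (b S)) => // S Si.
by have := congr1 g (bE S Si); rewrite linearB gh linear0 kdiff_linear.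
Qed.

Section FreeCover.
Variable P : lmodType R.

(** The canonical map onto [P] from the free module on its underlying set. *)
Definition free_cover (f : monalg.malg P R) : P :=
  \sum_(y <- monalg.msupp f) monalg.mcoeff y f *: y.

Lemma free_coverE (D : {fset P}) f : (monalg.msupp f `<=` D)%fset ->
  free_cover f = \sum_(y <- D) monalg.mcoeff y f *: y.
Proof.
move=> fD; apply: big_fset_incl => // y _ yf.
by rewrite monalg.mcoeff_outdom // scale0r.
Qed.

Lemma free_cover_is_linear : linear free_cover.
Proof.
move=> a f g; pose D := (monalg.msupp f `|` monalg.msupp g)%fset.
rewrite !(@free_coverE D) ?fsubsetUl ?fsubsetUr //; last first.
  apply: fsubset_trans (monalg.msuppD_le _ _) _; rewrite fsubUset fsubsetUr andbT.
  by apply: fsubset_trans (monalg.msuppZ_le _ _) _; rewrite fsubsetUl.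
rewrite scaler_sumr -big_split; apply: eq_bigr => y _ /=.
by rewrite monalg.mcoeffD monalg.mcoeffZ scalerDl scalerA.
Qed.

HB.instance Definition _ := GRing.isLinear.Build R (monalg.malg P R) P *:%R
  free_cover free_cover_is_linear.

Lemma free_coverU y : free_cover (monalg.mkmalgU y 1) = y.
Proof.
rewrite (@free_coverE [fset y]%fset) ?monalg.msuppU_le // big_seq_fset1.
by rewrite monalg.mcoeffUU scale1r.
Qed.

End FreeCover.

(** Lifting the identity along [free_cover] makes [P] a direct summand of a free module. *)
Lemma kvanish_projective (P : lmodType R) i : projective P -> (0 < i)%N ->
  kvanish var (full_submod (L := P)) null_submod i.
Proof.
move=> projP i0.
have [|h hP] := projP _ _ (@free_cover P : {linear monalg.malg P R -> P})
  (idfun : {linear P -> P}).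
  by move=> y; exists (monalg.mkmalgU y 1); apply: free_coverU.
exact: kvanish_retract hP (kvanish_malg i0).
Qed.

Lemma projective_rV m : projective 'rV[R]_m.
Proof.
move=> M N g f g_onto.
have /choice[b bP] (j : 'I_m) : exists y, g y = f (delta_mx 0 j) by apply: g_onto.
pose h (v : 'rV[R]_m) : M := \sum_j v 0 j *: b j.
have h_lin : linear h.
  move=> a u v; rewrite scaler_sumr -big_split; apply: eq_bigr => j _ /=.
  by rewrite !mxE scalerDl scalerA.
pose hL := GRing.isLinear.Build _ _ _ _ h h_lin.
exists (HB.pack_for {linear 'rV[R]_m -> M} h hL) => v.
rewrite /= /h linear_sum [in RHS](row_sum_delta v) linear_sum.
by apply: eq_bigr => j _; rewrite !linearZ bP.
Qed.

Lemma kvanish_resolution (M : lmodType R) p i :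
  projective_resolution_of_length M p -> (p < i)%N ->
  kvanish var (full_submod (L := M)) null_submod i.
Proof.
move=> [P [d [e [Pproj e_onto e_ex d_ex Pbig]]]] pi.
(* [P t] modulo [K t] is the [t]-th syzygy module of [M], and [K t] is isomorphic to [P t.+1] modulo
   [K t.+1]. Dimension shifting stops at [t > p], where [P t] is zero. *)
pose K t : P t -> Prop := match t with
  | 0 => fun x => e x = 0
  | t'.+1 => fun x => d t' x = 0 end.
have sK t : is_submod (K t).
  by case: t => [|t]; split=> [|a u v]; rewrite /K ?linear0 // linearP => -> ->;
    rewrite scaler0 addr0.
have KP t (y : P t) : K t y <-> exists x, d t x = y.
  by case: t y => [|t] y; [apply: e_ex | apply: d_ex].
suff h t j : (p < j + t)%N -> kvanish var full_submod (K t) j.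
  have := h 0%N i; rewrite addn0 => /(_ pi).
  apply: (@kvanish_transport _ _ _ _ _ e _ _ full_submod null_submod) => //.
    exact: null_submodP.
  by move=> y _; have [x <-] := e_onto y; exists x => //; rewrite subrr.
have [l] := ubnP (p.+1 - t); elim: l => // l IH in t j * => tl pjt.
have [pt|tp] := ltnP p t.
  move=> c _ _; exists (fun=> 0) => // S _; rewrite (Pbig t pt (_ - _)).
  exact: submod0.
case: j pjt => [|j] pjt; first by lia.
have null_K u : null_submod u -> K t u by move->; apply: submod0.
apply: (@kvanish_ses _ _ _ _ _ null_submod) => //; first exact: null_submodP.
  exact: kvanish_projective.
apply: (@kvanish_transport _ _ _ _ _ (d t) full_submod (K t.+1)) => //.
- exact: null_submodP.
- by move=> y _; apply/KP; exists y.
- by move=> y /KP[z <-]; exists z => //; rewrite subrr.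
by apply: IH; lia.
Qed.

End Projective.

(** * Hochster's formula in degree [p] *)

Section HomologyDim.
Variables (k : fieldType) (a b c : nat).
Variables (din : 'M[k]_(c, a)) (dout : 'M[k]_(a, b)).

Let rank_ker : (\rank (kermx din^T) = a - \rank din)%N.
Proof. by rewrite mxrank_ker mxrank_tr. Qed.

(** On columns the same matrices form the dual complex, whose cohomology has the same dimension by
    counting ranks. *)
Lemma homology_dim_eq0 (u : 'cV_a) : din *m dout = 0 ->
  homology_dim din dout = 0%N -> din *m u = 0 -> exists y, u = dout *m y.
Proof.
move=> dd h du.
have ker_sub y : din *m y = 0 -> (y^T <= kermx din^T)%MS.
  by move=> dy; apply/sub_kermxP; rewrite -trmx_mul dy trmx0.
have rk : (\rank (kermx din^T) <= \rank dout^T)%N.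
  move: h; rewrite /homology_dim mxrank_ker rank_ker mxrank_tr.
  by have := rank_leq_row dout; lia.
have sub : (dout^T <= kermx din^T)%MS.
  by apply/sub_kermxP; rewrite -trmx_mul dd trmx0.
have ker_dout : (kermx din^T <= dout^T)%MS.
  by rewrite -(geq_leqif (mxrank_leqif_sup sub)).
have /submxP[y yE] := submx_trans (ker_sub _ _ du) ker_dout.
by exists y^T; rewrite -[u]trmxK yE trmx_mul trmxK.
Qed.

Lemma homology_dim_neq0 : homology_dim din dout <> 0%N ->
  exists2 u : 'cV_a, din *m u = 0 & forall y, u <> dout *m y.
Proof.
move=> h; have /row_subPn[i ui] : ~~ (kermx din^T <= dout^T)%MS.
  apply/negP => /mxrankS; rewrite rank_ker mxrank_tr => rk; apply: h.
  by rewrite /homology_dim mxrank_ker; have := rank_leq_col din; lia.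
exists (row i (kermx din^T))^T.
  by apply: trmx_inj; rewrite trmx_mul trmxK -row_mul mulmx_ker row0 trmx0.
move=> y yE; case/negP: ui; apply/submxP; exists y^T.
by rewrite -trmx_mul -yE trmxK.
Qed.

End HomologyDim.

(** * Koszul chains of squarefree multidegree as simplicial cochains *)

Section SimplicialCochains.
Variables (k : fieldType) (n : nat) (Delta : {set {set 'I_n}}) (W : {set 'I_n}).
Hypothesis downD : down_closed Delta.
Local Notation DW := (induced Delta W).
Implicit Types (F G S T : {set 'I_n}) (g : {set 'I_n} -> k).

(** On the part of multidegree with support [S], each variable acts as one or zero, and these
    scalars replace the variables in [kdiff]. *)
Definition support_weight S : 'I_n -> k := fun v => (v \in S)%:R.

(* The sign of the isomorphism between the part of multidegree [W] of the Koszul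
   complex and the simplicial cochains of the restriction of [Delta] to [W]. *)
Definition comp_sign F : k := \prod_(u in F) ksign k u W.

Lemma comp_signM F : comp_sign F * comp_sign F = 1.
Proof. by rewrite -big_split big1 // => u _; apply: ksignM. Qed.

Lemma comp_signD1 v F : v \in F -> comp_sign F = ksign k v W * comp_sign (F :\ v).
Proof. by move=> vF; rewrite /comp_sign (big_setD1 v). Qed.

Lemma ksign_comp v F : F \subset W -> ksign k v W = ksign k v (W :\: F) * ksign k v F.
Proof.
move=> FW; rewrite /ksign -exprD; congr (_ ^+ _).
rewrite -(cardsID F [set u in W | (u < v)%N]) addnC.
congr (_ + _)%N; congr #|pred_of_set _|; apply/setP=> u; rewrite !inE.
  by case: (u \in F) (u \in W) => [] [].
by case uF: (u \in F); rewrite ?(subsetP FW u uF) ?andbT // andbF.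
Qed.

Lemma mem_faces F m : (F \in faces DW m) = [&& F \in Delta, F \subset W & #|F| == m].
Proof. by rewrite !inE andbA. Qed.

Definition cochain m g : 'cV[k]_#|faces DW m| := \col_i g (enum_val i).

Definition cochain_fun m (u : 'cV[k]_#|faces DW m|) F : k :=
  \sum_(i | enum_val i == F) u i 0.

Lemma cochain_funE m (u : 'cV[k]_#|faces DW m|) i : cochain_fun u (enum_val i) = u i 0.
Proof.
rewrite /cochain_fun (bigD1 i) //= big1 ?addr0 // => j /andP[/eqP/enum_val_inj->].
by rewrite eqxx.
Qed.

Lemma cochain_funK m (u : 'cV[k]_#|faces DW m|) : cochain m (cochain_fun u) = u.
Proof. by apply/matrixP=> i j; rewrite mxE cochain_funE ord1. Qed.

Lemma boundary_cochain q g :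
  boundary k DW q *m cochain q g =
  cochain q.+1 (fun F => \sum_(v in F) ksign k v F * g (F :\ v)).
Proof.
apply/matrixP=> i j; rewrite !mxE.
have := enum_valP i; rewrite mem_faces => /and3P[FD FW /eqP Fq].
set F := enum_val i in FD FW Fq *.
transitivity (\sum_(v in F) \sum_(l : 'I_#|faces DW q| | enum_val l == F :\ v)
    ksign k v F * g (F :\ v)).
  rewrite (exchange_big_dep xpredT) //=; apply: eq_bigr => l _.
  by rewrite !mxE mulr_suml; apply: eq_big => [v|v /andP[_ /eqP ->]].
apply: eq_bigr => v vF.
have Fv : F :\ v \in faces DW q.
  rewrite mem_faces (downD FD) ?subD1set // (subset_trans (subD1set _ _) FW) /=.
  by apply/eqP; have := cardsD1 v F; rewrite vF Fq add1n => -[->].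
rewrite (big_pred1 (enum_rank_in Fv (F :\ v))) // => l /=.
by rewrite -(inj_eq enum_val_inj) enum_rankK_in.
Qed.

(** Removing a vertex from the face [F] amounts to adding it to [W :\: F]; vertices outside [W] have
    weight zero. *)
Lemma boundary_kdiff q (b : {set 'I_n} -> k^o) :
  boundary k DW q *m cochain q (fun G => comp_sign G * b (W :\: G)) =
  cochain q.+1 (fun F => comp_sign F * kdiff (support_weight W) b (W :\: F)).
Proof.
rewrite boundary_cochain; apply/matrixP=> i j; rewrite !mxE.
have := enum_valP i; rewrite mem_faces => /and3P[_ FW _].
set F := enum_val i in FW *; rewrite /kdiff [X in _ * X](bigID (mem W)) /=.
rewrite [X in _ + X]big1 ?addr0 => [|v /andP[_ vW]]; last first.
  by rewrite /support_weight (negbTE vW) mulr0 scale0r.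
rewrite mulr_sumr; apply: eq_big => [v|v vF].
  rewrite !inE negb_and negbK; case vF: (v \in F); last by case: (v \in W).
  by rewrite (subsetP FW v vF).
have vW := subsetP FW v vF.
have -> : W :\: (F :\ v) = v |: (W :\: F).
  by apply/setP=> u; rewrite !inE; case: eqP => //= ->; rewrite vW.
rewrite /support_weight vW mulr1 -[_ *: _]/(_ * _) mulrA [RHS]mulrA.
congr (_ * _); rewrite (comp_signD1 vF) (ksign_comp v FW).
by rewrite -[LHS]mul1r -(ksignM k v (W :\: F)); ring.
Qed.

Lemma exists_cochain q (u : 'cV[k]_#|faces DW q|) : exists b : {set 'I_n} -> k^o,
  u = cochain q (fun G => comp_sign G * b (W :\: G)).
Proof.
exists (fun S => comp_sign (W :\: S) * cochain_fun u (W :\: S)).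
rewrite -[LHS]cochain_funK; apply/matrixP=> l l'; rewrite !mxE.
have := enum_valP l; rewrite mem_faces => /and3P[_ GW _].
by rewrite setDDr setDv set0U (setIidPr GW) mulrA comp_signM mul1r.
Qed.

(** Inherited from [kdiff_kdiff], one column at a time. *)
Lemma boundary_boundary q : boundary k DW q.+1 *m boundary k DW q = 0.
Proof.
apply/matrixP=> i j; set M := _ *m _.
have -> : M i j = (M *m delta_mx j (0 : 'I_1)) i 0 by rewrite -colE [RHS]mxE.
have [b ->] := exists_cochain (delta_mx j (0 : 'I_1)).
by rewrite /M -mulmxA !boundary_kdiff !mxE kdiff_kdiff mulr0.
Qed.

End SimplicialCochains.

(** * The multigraded pieces of the Koszul complex *)

Section Multidegrees.
Variables (k : fieldType) (n : nat) (Delta : {set {set 'I_n}}).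
Hypothesis downD : down_closed Delta.
Local Notation R := {mpoly k[n]}.
Local Notation var := (fun i : 'I_n => 'X_i : R).
Local Notation I := (face_ideal (k := k) (~: Delta)).
Implicit Types (F S T W : {set 'I_n}) (a m : 'X_{1..n}).

(* The part of multidegree [a] of a Koszul chain. *)
Definition mcomp a (c : {set 'I_n} -> R^o) S : k^o :=
  if S \subset mvars a then (c S : R)@_(a - mesym1 S) else 0.

Lemma submK_mvars a S : S \subset mvars a -> (a - mesym1 S + mesym1 S)%MM = a.
Proof.
move=> Sa; rewrite submK //; apply/mnm_lepP => i; rewrite mnmE.
by have := subsetP Sa i; rewrite inE; case: (i \in S); case: (a i) => // /(_ isT).
Qed.

Lemma mcomp_shift m c S : mcomp (m + mesym1 S) c S = (c S : R)@_m.
Proof. by rewrite /mcomp mvarsD mvars_mesym1 subsetUr addmK. Qed.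

Lemma mcomp_kdiff a c S : S \subset mvars a ->
  mcomp a (kdiff var c) S = kdiff (support_weight k (mvars a)) (mcomp a c) S.
Proof.
move=> Sa; rewrite /mcomp Sa [LHS]raddf_sum; apply: eq_bigr => v vS /=.
have -> : (ksign R v S * 'X_v) *: c (v |: S) =
    (-1) ^+ #|[set u in S | (u < v)%N]| *: ('X_v * (c (v |: S) : R)) :> R.
  rewrite -[LHS]/(_ * _) -mulrA /ksign -[in LHS]signr_odd -[in RHS]signr_odd.
  by case: odd; rewrite ?expr0 ?mul1r ?scale1r // !expr1 mulN1r scaleN1r.
rewrite mcoeffZ -[_ *: _ in RHS]/(_ * _) -mulrA; congr (_ * _).
rewrite /support_weight; have [va|va] := boolP (v \in mvars a); last first.
  (* A multiple of [x_v] has no monomial avoiding [v]; the prime ideal of the full vertex set is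
     zero, so [prime_ideal_addX] describes the ideal of [x_v]. *)
  rewrite mul0r; have /prime_ideal_addX h : v \in [set: 'I_n] by rewrite inE.
  have /h/(_ _)-> // : add_scaled (face_ideal (prime_family [set: 'I_n])) 'X_v
      full_submod ('X_v * (c (v |: S) : R)).
    by exists 0, (c (v |: S)); split=> //; [move=> m _; rewrite mcoeff0 | rewrite add0r].
  rewrite inE negbK; apply/subsetP=> u; rewrite !inE mnmBE andbT => au.
  by apply: contraNneq va => <-; rewrite inE; lia.
have vSa : v |: S \subset mvars a by rewrite subUset sub1set va.
rewrite vSa mul1r -[RHS](mcoeffXM _ U_(v)%MM); congr (_@__).
apply/mnmP=> u; rewrite mnmDE !mnmBE !mnmE !inE eq_sym.
case: (eqVneq u v) => [->|//]; rewrite (negbTE vS) /=.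
by move: va; rewrite inE; lia.
Qed.

(* Exactness, in Koszul degree [p], of the part of multidegree [a] of the Koszul
   complex of [R / I]. *)
Definition exact_at a p : Prop := forall g : {set 'I_n} -> k^o,
  (forall T, #|T|.+1 = p -> T \subset mvars a -> mvars (a - mesym1 T) \in Delta ->
     kdiff (support_weight k (mvars a)) g T = 0) ->
  exists b, forall S, #|S| = p -> S \subset mvars a ->
    mvars (a - mesym1 S) \in Delta ->
    g S = kdiff (support_weight k (mvars a)) b S.

(** Since [a v] is at least two, moving [v] in or out of [S] does not change the support of
    [a - mesym1 S]; hence [khomot v] is a contracting homotopy. *)
Lemma exact_at_nonsquarefree a p v : (1 < a v)%N -> exact_at a p.
Proof.
move=> av g gE; exists (khomot v g) => S Sp Sa aS.
have := khomotK (support_weight k (mvars a)) v g S.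
have -> : support_weight k (mvars a) v = 1.
  by rewrite /support_weight inE -lt0n (ltnW av).
rewrite scale1r => <-; rewrite [X in _ + X = _](_ : _ = 0) ?addr0 //.
rewrite /khomot; case: ifP => // vS; rewrite gE ?scaler0 //.
- by rewrite -Sp (cardsD1 v S) vS.
- exact: subset_trans (subD1set _ _) Sa.
rewrite (_ : mvars _ = mvars (a - mesym1 S)) //; apply/setP=> u.
rewrite !inE !mnmE !inE; have [->|//] := eqVneq u v.
by rewrite vS; lia.
Qed.

(** The condition on [S] says that [W :\: S] is a face, with [q.+1] elements when [#|S| = p]; so
    this piece is the cochain complex of [induced Delta W]. *)
Lemma exact_at_squarefree W p q : (#|W| = p + q.+1)%N ->
  reduced_homology_dim k (induced Delta W) q = 0%N -> exact_at (mesym1 W) p.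
Proof.
move=> Wpq hq g; rewrite !mvars_mesym1 => gE.
have compF F : F \subset W -> mvars (mesym1 W - mesym1 (W :\: F)) = F.
  move=> FW; apply/setP=> u; rewrite !inE !mnmE !inE.
  by case uF: (u \in F); rewrite ?(subsetP FW u uF) // andTb; case: (u \in W).
have [|y yE] := homology_dim_eq0 (u := cochain Delta W q.+1
    (fun F => comp_sign k W F * g (W :\: F))) (boundary_boundary k W downD q) hq.
  rewrite boundary_kdiff //; apply/matrixP=> i j; rewrite !mxE.
  have := enum_valP i; rewrite mem_faces => /and3P[FD FW /eqP Fq].
  rewrite gE ?mulr0 //; last by rewrite compF.
    by have := subset_leq_card FW; rewrite cardsD (setIidPr FW) Fq; lia.
  exact: subsetDl.
have [b bE] := exists_cochain (W := W) y.
exists b => S Sp SW aS.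
have SWF : S = W :\: (W :\: S) by rewrite setDDr setDv set0U (setIidPr SW).
have SF : W :\: S \in faces (induced Delta W) q.+1.
  rewrite mem_faces subsetDl cardsD (setIidPr SW) Sp Wpq addKn eqxx andbT andbT.
  by move: aS; rewrite {1}SWF compF ?subsetDl.
move: yE; rewrite bE boundary_kdiff // => /matrixP/(_ (enum_rank_in SF (W :\: S)) 0).
rewrite !mxE enum_rankK_in // -SWF => /(congr1 (fun z => comp_sign k W (W :\: S) * z)).
by rewrite !mulrA comp_signM !mul1r.
Qed.

(* The vanishing of Koszul homology in Koszul degree [p] and internal degree
   [p + e]. *)
Definition graded_kvanish (L : lmodType R) (gr : nat -> L -> Prop)
    (B : L -> Prop) p e : Prop :=
  forall c : {set 'I_n} -> L, (forall S, #|S| = p -> gr e (c S)) ->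
  (forall T, #|T|.+1 = p -> B (kdiff var c T)) ->
  exists b, forall S, #|S| = p -> B (c S - kdiff var b S).

Lemma eq_kdiff_weight (w : 'I_n -> k) (b b' : {set 'I_n} -> k^o) S :
  (forall v, w v != 0 -> b (v |: S) = b' (v |: S)) -> kdiff w b S = kdiff w b' S.
Proof.
move=> h; apply: eq_bigr => v vS; have [->|wv] := eqVneq (w v) 0.
  by rewrite mulr0 !scale0r.
by rewrite h.
Qed.

Lemma graded_kvanish_quotient p e : (forall a, mdeg a = (p + e)%N -> exact_at a p) ->
  graded_kvanish (fun j (f : R^o) => (f : R) \is j.-homog) I p e.
Proof.
move=> ex c cH cE.
have /choice[b bE] a : exists b, mdeg a = (p + e)%N -> forall S, #|S| = p ->
    S \subset mvars a -> mvars (a - mesym1 S) \in Delta ->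
    mcomp a c S = kdiff (support_weight k (mvars a)) b S.
  have [ap|ap] := pselect (mdeg a = (p + e)%N); last by exists (fun=> 0).
  have [|b bE] := ex a ap (mcomp a c); last by exists b.
  by move=> T Tp Ta aT; rewrite -mcomp_kdiff // /mcomp Ta cE // inE negbK.
(* The coefficients of the glued bounding chain, cut off outside total degree [p + e] so that the
   sum defining [f] is finite. *)
pose E S m : k := if (mdeg m + #|S| == p + e)%N then b (m + mesym1 S)%MM S else 0.
pose f S : R^o := \sum_(m : 'X_{1..n < (p + e).+1}) E S m *: 'X_[m] : R.
exists f => S Sp m mD; rewrite inE negbK in mD.
have fE T m' : (f T : R)@_m' = E T m'.
  have [m'p|pm'] := ltnP (mdeg m') (p + e).+1; first by rewrite mcoeff_mpoly.
  rewrite /E gtn_eqF; last by lia.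
  rewrite raddf_sum big1 //= => l _; rewrite mcoeffZ mcoeffX.
  by case: eqP => [lm|]; rewrite ?mulr0 //; have := bmdeg l; rewrite lm; lia.
pose a := (m + mesym1 S)%MM.
have Sa : S \subset mvars a by rewrite mvarsD mvars_mesym1 subsetUr.
have am : (a - mesym1 S = m)%MM by rewrite addmK.
have ad : mdeg a = (mdeg m + p)%N by rewrite mdegD mdeg_mesym1 Sp.
rewrite mcoeffB -(mcomp_shift m (kdiff var f)) -(mcomp_shift m c) mcomp_kdiff //.
have mE T : T \subset mvars a -> mcomp a f T = if (mdeg a == p + e)%N then b a T else 0.
  move=> Ta; rewrite /mcomp Ta fE /E submK_mvars //.
  by rewrite -mdeg_mesym1 -mdegD submK_mvars.
have wE v : support_weight k (mvars a) v != 0 -> v |: S \subset mvars a.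
  rewrite /support_weight; case va: (v \in mvars a); rewrite ?eqxx //.
  by rewrite subUset sub1set va Sa.
have [ap|ap] := eqVneq (mdeg a) (p + e)%N.
  rewrite (bE a ap S Sp Sa) ?am //; apply/eqP; rewrite subr_eq0; apply/eqP.
  by apply: eq_kdiff_weight => v /wE/mE->; rewrite ap eqxx.
rewrite [X in _ - X](_ : _ = 0) ?subr0; last first.
  rewrite (@eq_kdiff_weight _ _ (fun=> 0)).
    by rewrite /kdiff big1 // => v _; rewrite scaler0.
  by move=> v /wE/mE->; rewrite (negbTE ap).
rewrite mcomp_shift (dhomog_nemf_coeff (cH S Sp)) //.
by apply: contraNneq ap => me; rewrite ad addnC eqn_add2l; apply/eqP; exact: me.
Qed.

(** Nonsquarefree multidegrees are always exact, so a nonzero class must come from a squarefree one,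
    the indicator of [W]. *)
Lemma exists_reduced_homology p q :
  ~ graded_kvanish (fun j (f : R^o) => (f : R) \is j.-homog) I p q.+1 ->
  exists2 W : {set 'I_n}, #|W| = (p + q.+1)%N &
    reduced_homology_dim k (induced Delta W) q <> 0%N.
Proof.
move=> h; apply: contrapT => hW; apply: h; apply: graded_kvanish_quotient => a ap.
have [[v av]|sq] := pselect (exists v, (1 < a v)%N).
  exact: exact_at_nonsquarefree av.
have aE : a = mesym1 (mvars a).
  apply/mnmP=> v; rewrite mnmE inE; have : (a v <= 1)%N.
    by rewrite leqNgt; apply/negP => av; apply: sq; exists v.
  by case: (a v) => [|[]].
have Wp : #|mvars a| = (p + q.+1)%N by rewrite -mdeg_mesym1 -aE.
rewrite aE; apply: (exact_at_squarefree Wp); apply: contrapT => hq.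
by apply: hW; exists (mvars a).
Qed.

(** A cocycle that is not a coboundary becomes a Koszul chain concentrated in multidegree [W]; a
    chain bounding it modulo the ideal would, in that multidegree, bound the cocycle. *)
Lemma reduced_homology_kvanish W p q : #|W| = (p + q.+1)%N ->
  reduced_homology_dim k (induced Delta W) q <> 0%N ->
  ~ kvanish var full_submod I p.
Proof.
move=> Wpq /homology_dim_neq0[u du uN] hv.
have [g gE] := exists_cochain (W := W) u.
pose W1 := mesym1 W.
pose c S : R^o := if S \subset W then g S *: 'X_[W1 - mesym1 S] else 0 : R.
have W1E F : F \subset W -> mesym1 F = (W1 - mesym1 (W :\: F))%MM.
  move=> FW; apply/mnmP=> v; rewrite !mnmE !inE.
  by case vF: (v \in F); rewrite ?(subsetP FW v vF) //; case: (v \in W).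
have cW S : S \subset W -> mcomp W1 c S = g S.
  by move=> SW; rewrite /mcomp mvars_mesym1 SW /c SW mcoeffZ mcoeffX eqxx mulr1.
have cN a S : a != W1 -> mcomp a c S = 0.
  move=> aW; rewrite /mcomp; case: ifP => // Sa; rewrite /c.
  case: ifP => [SW|_]; last by rewrite mcoeff0.
  rewrite mcoeffZ mcoeffX; case: eqP => [E|]; last by rewrite mulr0.
  case/eqP: aW; rewrite -(submK_mvars Sa) -E submK_mvars //.
  by rewrite mvars_mesym1.
have wW v S : S \subset W -> support_weight k W v != 0 -> v |: S \subset W.
  move=> SW; rewrite /support_weight subUset sub1set SW andbT.
  by case: (v \in W); rewrite ?eqxx.
have [//|T Tp m|b _ bE] := hv c.
  rewrite inE negbK => mD; rewrite -(mcomp_shift m (kdiff var c)).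
  rewrite mcomp_kdiff; last by rewrite mvarsD mvars_mesym1 subsetUr.
  have [aE|aN] := eqVneq (m + mesym1 T)%MM W1; last first.
    by rewrite /kdiff big1 // => v _; rewrite cN // scaler0.
  have TW : T \subset W by rewrite -(mvars_mesym1 W) -/W1 -aE mvarsD mvars_mesym1 subsetUr.
  have mE : mvars m = W :\: T.
    by apply/setP=> v; move/mnmP/(_ v): aE; rewrite !mnmE !inE;
      case: (v \in T); case: (v \in W); case: (m v) => [|[]].
  rewrite aE mvars_mesym1 (@eq_kdiff_weight _ _ g) => [|v /(wW _ _ TW)/cW//].
  have TF : W :\: T \in faces (induced Delta W) q.+2.
    by rewrite mem_faces -{1}mE mD subsetDl cardsD (setIidPr TW) Wpq -Tp; apply/eqP; lia.
  move: du; rewrite gE boundary_kdiff // => /matrixP/(_ (enum_rank_in TF (W :\: T)) 0).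
  rewrite !mxE enum_rankK_in // setDDr setDv set0U (setIidPr TW).
  move/(congr1 (fun z => comp_sign k W (W :\: T) * z)).
  by rewrite mulrA comp_signM mul1r mulr0.
apply: (uN (cochain Delta W q (fun G => comp_sign k W G * mcomp W1 b (W :\: G)))).
rewrite boundary_kdiff // gE; apply/matrixP=> i j; rewrite !mxE.
have := enum_valP i; rewrite mem_faces => /and3P[FD FW /eqP Fq].
set F := enum_val i in FD FW Fq *; congr (_ * _).
have SW : W :\: F \subset W by apply: subsetDl.
have SF : #|W :\: F| = p by rewrite cardsD (setIidPr FW) Fq Wpq; lia.
have FN : mvars (mesym1 F) \notin ~: Delta by rewrite mvars_mesym1 inE negbK.
have := bE _ SF _ FN; rewrite mcoeffB W1E // => /eqP; rewrite subr_eq0 => /eqP h.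
rewrite -(cW _ SW).
have -> : support_weight k W = support_weight k (mvars W1) by rewrite mvars_mesym1.
by rewrite -mcomp_kdiff ?mvars_mesym1 // /mcomp !mvars_mesym1 SW.
Qed.

End Multidegrees.

(** * Tor and Koszul homology *)

Section TorKoszul.
Variables (k : fieldType) (n : nat).
Local Notation R := {mpoly k[n]}.
Local Notation var := (fun i : 'I_n => 'X_i : R).
Variables (M : lmodType R) (grM : nat -> M -> Prop) (F : graded_free_resolution grM).
Local Notation free t := 'rV[R]_(gf_rank F t).
Local Notation shift := (gf_shift (g := F)).
Implicit Types (S T : {set 'I_n}).

Definition aug (v : free 0) : M := \sum_s v 0 s *: gf_aug s.

Lemma aug_is_linear : linear aug.
Proof.
move=> a u v; rewrite scaler_sumr -big_split; apply: eq_bigr => s _ /=.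
by rewrite !mxE scalerDl scalerA.
Qed.

HB.instance Definition _ := GRing.isLinear.Build R (free 0) M *:%R aug aug_is_linear.

Definition cycles t : free t -> Prop := match t with
  | 0 => fun v => aug v = 0
  | t'.+1 => fun v => v *m gf_diff F t' = 0
  end.

Lemma cyclesP t (v : free t) : cycles v <-> exists w, w *m gf_diff F t = v.
Proof. by case: t v => [|t] v; [apply: gf_exact0 | apply: gf_exact]. Qed.

Definition gr_free t e (v : free t) : Prop := forall s,
  if (shift s <= e)%N then v 0 s \is (e - shift s).-homog else v 0 s == 0.

Definition gr_proj t e (v : free t) : free t :=
  \row_s if (shift s <= e)%N then pihomog mdeg (e - shift s) (v 0 s) else 0.

Lemma gr_projP t e (v : free t) : gr_free e (gr_proj e v).
Proof. by move=> s; rewrite mxE; case: (shift s <= e)%N => //; apply: pihomogP. Qed.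

Lemma gr_proj_id t e (v : free t) : gr_free e v -> gr_proj e v = v.
Proof.
move=> vE; apply/rowP => s; rewrite mxE; have := vE s.
by case: (shift s <= e)%N => [/pihomog_dE|/eqP].
Qed.

Lemma gr_proj_kdiff t e (b : {set 'I_n} -> free t) S :
  kdiff var (fun T => gr_proj e (b T)) S = gr_proj e.+1 (kdiff var b S).
Proof.
apply/rowP => s; rewrite mxE /kdiff !summxE.
have homX v : ksign R v S * 'X_v \is 1.-homog.
  rewrite /ksign -signr_odd; case: odd; rewrite ?expr0 ?expr1 ?mul1r ?mulN1r ?rpredN;
  by rewrite dhomogX; apply/eqP; apply: mdeg1.
case: ifP => se.
  rewrite raddf_sum; apply: eq_bigr => v _ /=; rewrite !mxE (pihomogM _ _ (homX v)).
  have [se1|se1] := leqP (shift s) e; first by rewrite subSn //= subn1.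
  by rewrite mulr0; case: ifP => //; lia.
rewrite big1 // => v _; rewrite !mxE; case: ifP => se1; first by lia.
by rewrite mulr0.
Qed.

Lemma gr_free_diff t e (v : free t.+1) : gr_free e v -> gr_free e (v *m gf_diff F t).
Proof.
move=> vE s; have hE l : v 0 l * gf_diff F t l s != 0 ->
    (shift s <= e)%N /\ v 0 l * gf_diff F t l s \is (e - shift s).-homog.
  rewrite mulf_eq0 negb_or => /andP[vl /gf_diff_homog[d dh ld]].
  have := vE l; case: ifP => [le vh|_ v0]; last by rewrite v0 in vl.
  split; first by lia.
  have -> : (e - shift s = (e - shift l) + d)%N by lia.
  exact: dhomogM.
rewrite mxE; case: ifP => se.
  apply: rpred_sum => l _; have [->|/hE[]//] := eqVneq (v 0 l * gf_diff F t l s) 0.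
  exact: rpred0.
rewrite big1 // => l _; apply/eqP; apply: contraFT se.
by case/hE.
Qed.

Lemma kdiff_mulmx t (c : {set 'I_n} -> free t.+1) S :
  kdiff var (fun T => c T *m gf_diff F t) S = kdiff var c S *m gf_diff F t.
Proof. by rewrite mulmx_suml; apply: eq_bigr => v _; rewrite scalemxAl. Qed.

(* The connecting map [H_(i+1) (cokernel) -> H_i (kernel)] of the short exact
   sequences into which a resolution splits. *)
Lemma gr_connecting t i e (c : {set 'I_n} -> free t.+1) (b0 : {set 'I_n} -> free t) :
  graded_kvanish (@gr_free t) (@cycles t) i.+1 e ->
  (forall S, #|S| = i -> gr_free e.+1 (c S)) ->
  (forall S, #|S| = i -> c S *m gf_diff F t = kdiff var b0 S) ->
  exists w, forall S, #|S| = i -> cycles (c S - kdiff var w S).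
Proof.
(* Projecting [b0] to degree [e] keeps its boundary in degree [i], which is homogeneous of degree
   [e.+1]. *)
move=> hv cE cb; pose b' T := gr_proj e (b0 T).
have b'E S : #|S| = i -> kdiff var b' S = c S *m gf_diff F t.
  by move=> Si; rewrite gr_proj_kdiff -cb // gr_proj_id //; apply/gr_free_diff/cE.
have [S _|T [Ti]|z zE] := hv b'; first exact: gr_projP.
  by apply/cyclesP; exists (c T); rewrite b'E.
have /choice[w wE] S : exists w, #|S| = i.+1 -> w *m gf_diff F t = b' S - kdiff var z S.
  have [Si|Si] := eqVneq #|S| i.+1; last by exists 0 => /eqP; rewrite (negbTE Si).
  by have /cyclesP[w wE] := zE S Si; exists w.
exists w => S Si; rewrite /cycles mulmxBl -b'E // -kdiff_mulmx.
rewrite [X in _ - X](@eq_kdiff _ _ _ _ _ (fun T => b' T - kdiff var z T)).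
  by rewrite kdiffB kdiff_kdiff subr0 subrr.
by move=> T; rewrite Si; apply: wE.
Qed.

(** Free modules have no Koszul homology in positive degree. The shift preserves the internal
    degree: the Koszul degree drops by one while the coefficient degree rises by one. *)
Lemma graded_kvanish_syzygy t i e :
  graded_kvanish (@gr_free t) (@cycles t) i.+2 e ->
  graded_kvanish (@gr_free t.+1) (@cycles t.+1) i.+1 e.+1.
Proof.
move=> hv c cE cK.
have [||b _ bE] := @kvanish_projective k n _ i.+1 (@projective_rV k n (gf_rank F t))
  isT (fun S => c S *m gf_diff F t); first by [].
  by move=> T Ti; rewrite /null_submod kdiff_mulmx; apply: cK.
apply: (gr_connecting hv cE) => S Si.
by apply/eqP; rewrite -subr_eq0; apply/eqP/bE.
Qed.

Lemma mcoeff0_kdiff t (b : {set 'I_n} -> free t) S s :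
  (kdiff var b S 0 s)@_0%MM = 0.
Proof.
rewrite /kdiff summxE raddf_sum big1 //= => v _; rewrite mxE -mulrA mulrCA.
by rewrite rmorphM /= mcoeffX mnm1_eq0 mul0r.
Qed.

(** An entry with nonzero constant term is homogeneous of degree [0], so it links generators of
    equal degree. *)
Lemma mcoeff0_diff t j (l : 'I_(gf_rank F t.+1)) (s : 'I_(gf_rank F t)) :
  (gf_diff F t l s)@_0%MM != 0 -> (shift l == j) = (shift s == j).
Proof.
move=> h; have d0 : gf_diff F t l s != 0 by apply: contraNneq h => ->; rewrite mcoeff0.
have [e eh ->] := gf_diff_homog d0; suff -> : e = 0%N by rewrite addn0.
apply/eqP; apply: contraNT h => e0; apply/eqP; apply: (dhomog_nemf_coeff eh).
by rewrite -[mf0 in mf0 != _]/(mdeg 0%MM) mdeg0 eq_sym.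
Qed.

Lemma tor_diff_mul t j (y : free t.+1) (a : 'I_#|gens F t j|) :
  ((y *m gf_diff F t) 0 (enum_val a))@_0%MM =
  ((\row_b (y 0 (enum_val b))@_0%MM) *m tor_diff F t j) 0 a.
Proof.
rewrite !mxE raddf_sum /=.
transitivity (\sum_(l in gens F t.+1 j)
   (y 0 l)@_0%MM * (gf_diff F t l (enum_val a))@_0%MM).
  rewrite [LHS](bigID (mem (gens F t.+1 j))) /= [X in _ + X]big1 ?addr0.
    by apply: eq_bigr => l _; rewrite rmorphM.
  move=> l lj; rewrite rmorphM /=; apply/eqP; rewrite mulf_eq0; apply/orP; right.
  apply: contraNT lj => /(mcoeff0_diff j) h; rewrite inE h.
  by have := enum_valP a; rewrite inE.
by rewrite big_enum_val; apply: eq_bigr => l _; rewrite !mxE.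
Qed.

Definition lift_gens t j (u : 'rV[k]_#|gens F t j|) : free t :=
  \row_s \sum_(a | enum_val a == s) (u 0 a)%:MP.

Lemma lift_gensE t j (u : 'rV[k]_#|gens F t j|) a :
  (lift_gens u 0 (enum_val a))@_0%MM = u 0 a.
Proof.
rewrite mxE (bigD1 a) //= big1 ?addr0 ?mcoeffC ?eqxx ?mulr1 // => b.
by case/andP=> /eqP/enum_val_inj->; rewrite eqxx.
Qed.

Lemma lift_gens_homog t j (u : 'rV[k]_#|gens F t j|) : gr_free j (lift_gens u).
Proof.
move=> s; rewrite mxE; have [sj|sj] := boolP (s \in gens F t j).
  move: sj; rewrite inE => /eqP->; rewrite leqnn subnn; apply: rpred_sum => a _.
  by rewrite -[_%:MP]mulr1 mul_mpolyC; apply: dhomogZ; apply: dhomog1.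
rewrite big1 ?rpred0 ?eqxx ?if_same // => a /eqP aE; case/negP: sj; rewrite -aE.
exact: enum_valP.
Qed.

(** A value of [kdiff var w] at [set0] has no constant terms. So [u] is the reduction of an element
    of [cycles], that is, of an image under [gf_diff]. *)
Lemma tor_dim_of_lift t j b (dout : 'M[k]_(#|gens F t j|, b)) :
  (forall u : 'rV[k]_#|gens F t j|, u *m dout = 0 ->
     exists w, cycles (lift_gens u - kdiff var w set0)) ->
  homology_dim (tor_diff F t j) dout = 0%N.
Proof.
move=> h; apply/eqP; rewrite subn_eq0; apply: mxrankS; apply/row_subP => i.
have [|w /cyclesP[y yE]] := h (row i (kermx dout)).
  by rewrite -row_mul mulmx_ker row0.
apply/submxP; exists (\row_b (y 0 (enum_val b))@_0%MM); apply/rowP => a.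
rewrite -tor_diff_mul yE [X in X@_ _]mxE [X in _ + X]mxE.
by rewrite mcoeffB lift_gensE mcoeff0_kdiff subr0.
Qed.

(** For positive Koszul degree the vanishing is shifted down to [H_1] of a syzygy module, and the
    connecting map to degree [0] corrects each lifted cycle by an element of [(x_1, ..., x_n)] times
    the free module. *)
Lemma tor_dim_eq0 p e :
  graded_kvanish (@gr_free 0) (@cycles 0) p e -> tor_dim F p (p + e) = 0%N.
Proof.
case: p => [|p] hv.
  apply: tor_dim_of_lift => u _; rewrite add0n in u *.
  have [S _|//|b bE] := hv (fun=> lift_gens u); first exact: lift_gens_homog.
  by exists b; apply: bE; rewrite cards0.
have {}hv : graded_kvanish (@gr_free p) (@cycles p) 1 (p + e).
  suff h t i : graded_kvanish (@gr_free 0) (@cycles 0) (i + t).+1 e ->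
      graded_kvanish (@gr_free t) (@cycles t) i.+1 (t + e) by exact: (h p 0%N).
  elim: t i => [|t IH] i; first by rewrite addn0 add0n.
  by rewrite addnS -addSn => /IH; rewrite addSn; apply: graded_kvanish_syzygy.
rewrite addSn; apply: tor_dim_of_lift => u uE.
pose v := lift_gens u *m gf_diff F p.
(* In the relevant degree this is the cycle condition on [u]; for the other generators it holds by
   degree. *)
have v0 s : (v 0 s)@_0%MM = 0.
  have [sj|sj] := boolP (s \in gens F p (p + e).+1).
    rewrite -(enum_rankK_in sj sj) tor_diff_mul.
    rewrite (_ : \row_b _ = u); last by apply/rowP => a; rewrite mxE lift_gensE.
    by rewrite uE mxE.
  rewrite mxE raddf_sum big1 //= => l _; rewrite rmorphM /=; apply/eqP.
  rewrite mulf_eq0 -implyNb; apply/implyP => ul; apply: contraNT sj.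
  move/(mcoeff0_diff (p + e).+1); rewrite [s \in _]inE => <-.
  apply: contraNT ul => lj; rewrite mxE big1 ?mcoeff0 // => a /eqP aE.
  by have := enum_valP a; rewrite aE inE (negbTE lj).
have /choice[y yE] s : exists y : 'I_n -> R, v 0 s = \sum_i y i * 'X_i.
  exact: in_span_var.
(* Only singletons matter for the boundary at [set0], and there the sum over [S] is a single
   [y s i]. *)
have [||w wE] := gr_connecting (c := fun=> lift_gens u) (i := 0) (e := p + e)
   (b0 := fun S => \row_s \sum_(i in S) y s i) hv.
- by move=> S _; apply: lift_gens_homog.
- move=> S /eqP; rewrite cards_eq0 => /eqP ->; apply/rowP => s; rewrite yE.
  rewrite /kdiff summxE; apply: eq_big => i; first by rewrite inE.
  by move=> _; rewrite !mxE setU0 big_set1 ksign0 mul1r mulrC.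
by exists w; apply: wE; rewrite cards0.
Qed.

End TorKoszul.

(** * Depth of Stanley-Reisner rings *)

Section StanleyReisnerDepth.
Variables (k : fieldType) (n : nat) (Delta : {set {set 'I_n}}).
Hypothesis downD : down_closed Delta.
Local Notation R := {mpoly k[n]}.
Local Notation var := (fun i : 'I_n => 'X_i : R).
Local Notation I := (face_ideal (k := k) (~: Delta)).
Local Notation M := (SR_quot k Delta).

Let sI : is_submod I := face_idealP k (down_closedC downD).

Definition SR_proj (f : R^o) : M := SR_pi Delta f.

Lemma SR_proj_is_linear : linear SR_proj.
Proof.
move=> a f g; rewrite /SR_proj SR_piD; congr (_ + _).
by rewrite -[a *: f]/(a * f) -SR_scale_pi.
Qed.

HB.instance Definition _ := GRing.isLinear.Build R R^o M *:%R SR_proj SR_proj_is_linear.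

Lemma SR_proj_eq0 f : SR_proj f = 0 <-> I f.
Proof.
have <- : SR_proj 0 = 0 by rewrite linear0.
apply: (@iff_trans _ ((f : R) \in @SR_ideal k n Delta)); last exact: SR_idealP.
rewrite -[f in f \in _]subr0 Quotient.idealrBE /SR_proj /SR_pi.
by split=> [->|/eqP].
Qed.

Lemma kvanish_SR_quot i :
  kvanish var (full_submod (L := M)) null_submod i -> kvanish var full_submod I i.
Proof.
apply: (@kvanish_reflect _ _ _ _ _ SR_proj) => //.
- exact: null_submodP.
- move=> x _; have [f ->] := SR_piP x; exists f => //.
  by rewrite /null_submod subrr.
by move=> f _; exact: SR_proj_eq0.
Qed.

Lemma in_seqM_SR_proj (s : seq R) f :
  in_seqM s (SR_proj f) <-> quot_by I full_submod s f.
Proof.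
have sQ : is_submod (quot_by I full_submod s) by apply: quot_by_submod.
split=> [[y yE]|].
  have /choice[g gE] j : exists g, y j = SR_proj g by apply: SR_piP.
  rewrite -[f](subrK (\sum_(j < size s) s`_j *: (g j : R^o))); apply: submodD => //.
    apply: quot_by_incl => //; apply/SR_proj_eq0.
    rewrite linearB linear_sum /= yE; apply/eqP; rewrite subr_eq0; apply/eqP.
    by apply: eq_bigr => j _; rewrite gE linearZ.
  by apply: (submod_sum sQ) => j _; apply: quot_by_mem => //; apply: mem_nth.
apply: (@quot_by_min _ _ I full_submod (fun g => in_seqM s (SR_proj g)))
  => [|g /SR_proj_eq0->|y g /(nthP 0)[j js <-] _].
- split=> [|a u v [y yE] [z zE]].
    by exists (fun=> 0); rewrite linear0 big1 // => j _; rewrite scaler0.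
  exists (fun j => a *: y j + z j); rewrite linearP /= yE zE scaler_sumr -big_split.
  by apply: eq_bigr => j _; rewrite /= scalerDr !scalerA mulrC.
- by exists (fun=> 0); rewrite big1 // => j _; rewrite scaler0.
exists (fun l => if l == Ordinal js then SR_proj g else 0).
rewrite (bigD1 (Ordinal js)) //= eqxx big1 ?addr0 ?linearZ // => l /negbTE->.
by rewrite scaler0.
Qed.

Lemma regular_sequence_wreg (s : seq R) :
  regular_sequence M s -> wreg full_submod I s.
Proof.
case=> h _; apply/wregP => i ik f _ hf; apply/in_seqM_SR_proj; apply: h => //.
by rewrite -[_ *: _]linearZ; apply/in_seqM_SR_proj.
Qed.

Lemma wreg_regular_sequence (s : seq R) : set0 \in Delta ->
  (forall f, f \in s -> irrelevant_ideal f) ->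
  wreg full_submod I s -> regular_sequence M s.
Proof.
move=> D0 sm /wregP h; split.
  move=> i ik x; have [f ->] := SR_piP x.
  move=> hf; apply/(in_seqM_SR_proj _ f); apply: h => //; apply/in_seqM_SR_proj.
  by rewrite linearZ.
(* Neither the ideal, as [set0] is a face, nor the multiples of entries of [s] have a constant term,
   so [1] is not reached. *)
exists (SR_proj 1) => /in_seqM_SR_proj hs.
suff : (1 : R)@_0%MM = 0 by rewrite mcoeff1 eqxx => /eqP; rewrite oner_eq0.
apply: (@quot_by_min _ _ I full_submod (fun f : R^o => (f : R)@_0%MM = 0)) hs => //.
- split=> [|a u v hu hv]; first by rewrite mcoeff0.
  by rewrite mcoeffD hv addr0 -[a *: u]/(a * u) rmorphM /= hu mulr0.
- move=> f; apply; rewrite inE negbK (_ : mvars _ = set0) //.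
  by apply/setP=> i; rewrite !inE mnmE eqxx.
by move=> y f /sm y0 _; rewrite -[y *: f]/(y * f) rmorphM /= y0 mul0r.
Qed.

(** Homogeneous lifts [g s] of the images of the generators give a degree-preserving map [phi] to
    the polynomial ring, which identifies the first free module modulo [cycles] with [R/I]. *)
Lemma graded_kvanish_SR_resolution (F : graded_free_resolution (@SR_graded k n Delta)) p e :
  graded_kvanish (fun j (f : R^o) => (f : R) \is j.-homog) I p e ->
  graded_kvanish (@gr_free k n M _ F 0) (@cycles k n M _ F 0) p e.
Proof.
move=> hv c cE cK.
have /choice[g gE] (s : 'I_(gf_rank F 0)) : exists g : R,
    g \is (gf_shift s).-homog /\ gf_aug s = SR_proj g :> M.
  by have [g gh ->] := gf_aug_homog (g := F) s; exists g.
pose phi (v : 'rV[R]_(gf_rank F 0)) : R^o := \sum_s v 0 s *: (g s : R^o).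
have phiE v : aug v = SR_proj (phi v).
  rewrite linear_sum; apply: eq_bigr => s _.
  by rewrite linearZ (proj2 (gE s)).
have phi_lin : linear phi.
  move=> a u v; rewrite scaler_sumr -big_split; apply: eq_bigr => s _ /=.
  by rewrite !mxE scalerDl scalerA.
pose phiL : {linear 'rV[R]_(gf_rank F 0) -> R^o} :=
  HB.pack_for {linear 'rV[R]_(gf_rank F 0) -> R^o} phi
    (GRing.isLinear.Build _ _ _ _ phi phi_lin).
have phi_kdiff b S : kdiff var (fun T => phi (b T)) S = phi (kdiff var b S).
  exact: (kdiff_linear _ phiL).
have cyclesE v : cycles (F := F) (t := 0) v <-> I (phi v).
  by rewrite /cycles phiE; apply: SR_proj_eq0.
have [S Sp|T Tp|b bE] := hv (fun S => phi (c S)).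
- apply: rpred_sum => s _; have := cE S Sp s; case: ifP => [se vh|_ /eqP->].
    rewrite -[_ *: _]/(_ * _) -[e](subnK se); apply: dhomogM => //.
    by case: (gE s).
  by rewrite scale0r; apply: rpred0.
- by rewrite phi_kdiff; apply/cyclesE/cK.
have /choice[b' b'E] S : exists v, I (b S - phi v).
  have [v vE] := gf_aug_surj F (SR_proj (b S)); exists v.
  by apply/SR_proj_eq0; rewrite linearB /= -phiE /aug -vE subrr.
exists b' => S Sp; apply/cyclesE.
have -> : phi (c S - kdiff var b' S) =
   (phi (c S) - kdiff var b S) + kdiff var (fun T => b T - phi (b' T)) S.
  by rewrite kdiffB phi_kdiff addrA subrK; apply: (linearB phiL).
by apply: (submodD sI); [apply: bE | apply: submod_kdiff].
Qed.

(* Auslander-Buchsbaum, with projective dimension measured by Koszul homology. *)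
Lemma SR_depth p : set0 \in Delta -> (p <= n)%N ->
  (forall i, (p < i)%N -> kvanish var full_submod I i) ->
  ~ kvanish var full_submod I p ->
  is_depth M (@irrelevant_ideal k n) (n - p).
Proof.
move=> D0 pn hv hp; split.
  exists (esyms k n (n - p)); rewrite size_esyms; split=> //.
    by move=> _ /mem_esyms[j /andP[j0 _] ->]; apply: mcoeff0_mesym.
  apply: wreg_regular_sequence => //.
    by move=> _ /mem_esyms[j /andP[j0 _] ->]; apply: mcoeff0_mesym.
  apply: esyms_regular; [exact: down_closedC | exact: leq_subr |].
  by move=> i ni; apply: hv; lia.
move=> s sm /regular_sequence_wreg ws; rewrite leqNgt; apply/negP => ns; apply: hp.
apply: kvanish_of_wreg ws _ => //; last by lia.
by move=> y /sm; apply: in_span_var.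
Qed.

End StanleyReisnerDepth.

(** * Clique complexes and the comparison of [con] with the depth *)

Lemma clique_complex_down n d (H : {set {set 'I_n}}) : down_closed (clique_complex d H).
Proof.
move=> F G; rewrite !inE => /forallP h GF; apply/forallP => E; apply/implyP.
by case/andP=> EG Ed; have := h E; rewrite (subset_trans EG GF) Ed.
Qed.

Lemma clique_complex0 n d (H : {set {set 'I_n}}) : (0 < d)%N -> set0 \in clique_complex d H.
Proof.
move=> d0; rewrite inE; apply/forallP => E; apply/implyP; rewrite subset0.
by case/andP=> /eqP->; rewrite cards0 eq_sym gtn_eqF.
Qed.

Lemma bigminn_leq (T : finType) (P : pred T) (f : T -> nat) x j :
  P j -> (\big[minn/x]_(i | P i) f i <= f j)%N.
Proof.
move=> Pj; have := mem_index_enum j; rewrite unlock.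
elim: (index_enum T) => //= i l IH; rewrite inE => /orP[/eqP <-|/IH h].
  by rewrite Pj geq_minl.
by case: ifP => _ //; rewrite geq_min h orbT.
Qed.

Theorem corollary5p10 (k : fieldType) (n d : nat) (H : {set {set 'I_n}})
  (d_ge2 : (2 <= d)%N)
  (H_simple : simple_hypergraph H)
  (H_uniform : uniform d H)
  (H_strand : maximal_linear_strand
                (@SR_graded k n (clique_complex d H)) d) :
  is_depth (SR_quot k (clique_complex d H)) (@irrelevant_ideal k n)
    (con k d H + d - 1)%N.
Proof.
have [p [b [[res _] [F Fb] b0]]] := H_strand.
pose q := (d - 2)%N; have dq : d = q.+2 by rewrite /q; lia.
have downD := @clique_complex_down n d H.
set Delta := clique_complex d H in downD *.
have hvan i : (p < i)%N ->
    kvanish (fun i : 'I_n => 'X_i) full_submod (face_ideal (k := k) (~: Delta)) i.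
  by move=> pi; apply: kvanish_SR_quot => //; apply: kvanish_resolution res pi.
have [W0 W0p hW0] : exists2 W : {set 'I_n}, #|W| = (p + q.+1)%N &
    reduced_homology_dim k (induced Delta W) q <> 0%N.
  apply: exists_reduced_homology => // hv; apply: b0; rewrite -Fb.
  have -> : (p + d - 1 = p + q.+1)%N by lia.
  by apply: tor_dim_eq0; apply: graded_kvanish_SR_resolution.
have W0n : (#|W0| <= n)%N by rewrite -[X in (_ <= X)%N]card_ord max_card.
(* The minimum is attained at the complement of [W0]. *)
have conE : con k d H = (n - (p + q.+1))%N.
  have conV (V : {set 'I_n}) : #|V| = (n - #|~: V|)%N by rewrite cardsCs card_ord.
  rewrite /con -/Delta -/q; apply/eqP; rewrite eqn_leq; apply/andP; split.
    rewrite -W0p -(setCK W0) -conV; apply: bigminn_leq.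
    by rewrite setCK; apply/eqP.
  apply: (big_ind (leq (n - (p + q.+1)))) => [||V /eqP hV]; first by lia.
    by move=> x y hx hy; rewrite leq_min hx.
  (* A complement with more than [p + q.+1] vertices would give nonzero Koszul homology above degree
     [p]. *)
  rewrite (conV V); apply: leq_sub2l.
  have [Vq|qV] := ltnP #|~: V| q.+1; first by lia.
  rewrite -(subnK qV) leq_add2r leqNgt; apply/negP => /hvan.
  by apply: reduced_homology_kvanish hV => //; rewrite subnK.
(* The truncated subtraction in [conE] is exact, because [W0] has [p + q.+1] elements and at most
   [n]. *)
have -> : (con k d H + d - 1 = n - p)%N by rewrite conE; lia.
apply: SR_depth => //; first by apply: clique_complex0; lia.
  by lia.
exact: reduced_homology_kvanish W0p hW0.
Qed.
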